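(* Let $A,B$ be finite-dimensional Hilbert spaces. For any bipartite quantum state $\rho_{AB}$ and any error tolerance $\varepsilon\in(0,1)$, $$E_{\mathrm{D},\mathrm{PPT}}^{(1),\varepsilon}(\rho_{AB}) \;=\; \min_{\substack{\|G^{T_B}\|_1\le 1\\ G=G^\dagger}} D_H^{\varepsilon}(\rho_{AB}\|G_{AB})\;-\;\delta,$$ where the minimum is over all Hermitian operators $G_{AB}$ on $A\otimes B$ (not necessarily positive semidefinite) with $\|G_{AB}^{T_B}\|_1\le 1$, and $\delta\in[0,1]$ is the least constant such that the right-hand side is the logarithm of an integer.
   Context: All Hilbert spaces are finite-dimensional; $\log$ is base $2$. A quantum state is a positive semidefinite operator of unit trace. $T_B$ denotes partial transpose on $B$ with respect to a fixed orthonormal product basis; $\|\cdot\|_1$ is the trace norm; $\mathbb 1$ is the identity. PPT operations: a completely positive trace-preserving linear map $\Pi_{AB\to A'B'}$ is a PPT operation if its Choi–Jamiołkowski matrix $J_\Pi=\sum_{i,j,m,k}|i_Aj_B\rangle\langle m_Ak_B|\otimes\Pi(|i_Aj_B\rangle\langle m_Ak_B|)$ satisfies $J_\Pi^{T_{BB'}}\ge 0$. For $k\in\mathbb N$, $k\ge1$, let $\Psi_k=\frac1k\sum_{i,j=0}^{k-1}|ii\rangle\langle jj|$ be the $k$-dimensional maximally entangled state on $A'\otimes B'$ with $\dim A'=\dim B'=k$. The fidelity of distillation is $F_{\mathrm{PPT}}(\rho_{AB},k)=\max_{\Pi\in \mathrm{PPT}}\operatorname{Tr}\,\Pi_{AB\to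 A'B'}(\rho_{AB})\Psi_k$, and the one-shot $\varepsilon$-error distillable entanglement under PPT operations is $$E_{\mathrm{D},\mathrm{PPT}}^{(1),\varepsilon}(\rho_{AB})=\log\max\{k\in\mathbb N: F_{\mathrm{PPT}}(\rho_{AB},k)\ge 1-\varepsilon\}.$$ Hypothesis testing relative entropy, for a state $\rho$ and a Hermitian operator $G$ (not necessarily positive): $$D_H^\varepsilon(\rho\|G)=-\log\min\{\operatorname{Tr}MG: 0\le M\le\mathbb 1,\ 1-\operatorname{Tr}M\rho\le\varepsilon\},$$ with the convention $\log x=-\infty$ for $x\le 0$ (so $D_H^\varepsilon=+\infty$ when the optimal value is $\le 0$). *)

(* Defs.v *)
From HB Require Import structures.
From mathcomp Require Import all_boot all_order all_algebra.
From mathcomp Require Import all_classical all_reals all_analysis.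
From mathcomp.real_closed Require Import complex mxtens.

Set Implicit Arguments.
Unset Strict Implicit.
Unset Printing Implicit Defensive.

Import Order.TTheory GRing.Theory Num.Theory.

Local Open Scope classical_set_scope.
Local Open Scope ring_scope.
Local Open Scope sesquilinear_scope.
Local Open Scope complex_scope.

(* Operators are matrices over R[i]: a Hilbert space of dimension a is R[i]^a
   with its standard basis, and the tensor product of spaces of dimensions a
   and b is R[i]^(a * b), whose basis vector |i>|j> has index
   mxtens_index (i, j), so that A *t B is the tensor product of A and B. *)

Definition is_max (disp : Order.disp_t) (T : porderType disp)
  (S : set T) (x : T) : Prop := S x /\ ubound S x.

Definition is_min (disp : Order.disp_t) (T : porderType disp)
  (S : set T) (x : T) : Prop := S x /\ lbound S x.

(* lne x = -oo for every x <= 0. *)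
Definition log2e (R : realType) (x : \bar R) : \bar R :=
  (lne x * ((ln 2)^-1)%:E)%E.

(* The order of R[i] makes 0 <= z imply that z is real; over R[i] this entails
   that M is Hermitian. *)
Definition psd (R : realType) (n : nat) (M : 'M[R[i]]_n) : Prop :=
  forall v : 'rV[R[i]]_n, 0 <= (v *m M *m v ^t*) 0 0.

Definition is_state (R : realType) (n : nat) (rho : 'M[R[i]]_n) : Prop :=
  psd rho /\ \tr rho = 1.

(* The real part only casts: the traces it is applied to below are real. *)
Definition rtrace (R : realType) (n : nat) (M : 'M[R[i]]_n) : R :=
  complex.Re (\tr M).

(* Sum of the singular values, i.e. the trace of the square root of X^* X;
   spectral_diag lists the eigenvalues of a normal matrix with multiplicity. *)
Definition trace_norm (R : realType) (n : nat) (X : 'M[R[i]]_n) : R :=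
  \sum_i Num.sqrt (complex.Re (spectral_diag (X ^t* *m X) 0 i)).

(* |i>|j> and |i'>|j'> are sent to |i>|j'>. *)
Definition swap_snd (a b : nat) (p q : 'I_(a * b)) : 'I_(a * b) :=
  mxtens_index ((mxtens_unindex p).1, (mxtens_unindex q).2).

Definition ptransB (R : realType) (a b : nat) (X : 'M[R[i]]_(a * b)) :
    'M[R[i]]_(a * b) :=
  \matrix_(p, q) X (swap_snd p q) (swap_snd q p).

(* Transposition of B and B' on (A (x) B) (x) (A' (x) B'). *)
Definition ptransBB (R : realType) (a b a' b' : nat)
    (X : 'M[R[i]]_((a * b) * (a' * b'))) : 'M[R[i]]_((a * b) * (a' * b')) :=
  \matrix_(p, q)
    X (mxtens_index (swap_snd (mxtens_unindex p).1 (mxtens_unindex q).1,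
                     swap_snd (mxtens_unindex p).2 (mxtens_unindex q).2))
      (mxtens_index (swap_snd (mxtens_unindex q).1 (mxtens_unindex p).1,
                     swap_snd (mxtens_unindex q).2 (mxtens_unindex p).2)).

(* id_d (x) Pi, block by block. *)
Definition ampliation (R : realType) (m n d : nat)
    (Pi : 'M[R[i]]_m -> 'M[R[i]]_n) (X : 'M[R[i]]_(d * m)) :
    'M[R[i]]_(d * n) :=
  \matrix_(p, q)
    Pi (\matrix_(r, s) X (mxtens_index ((mxtens_unindex p).1, r))
                         (mxtens_index ((mxtens_unindex q).1, s)))
       (mxtens_unindex p).2 (mxtens_unindex q).2.

Definition completely_positive (R : realType) (m n : nat)
    (Pi : 'M[R[i]]_m -> 'M[R[i]]_n) : Prop :=
  forall (d : nat) (X : 'M[R[i]]_(d * m)), psd X -> psd (ampliation Pi X).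

Definition trace_preserving (R : realType) (m n : nat)
    (Pi : 'M[R[i]]_m -> 'M[R[i]]_n) : Prop :=
  forall X : 'M[R[i]]_m, \tr (Pi X) = \tr X.

Definition choi (R : realType) (m n : nat)
    (Pi : 'M[R[i]]_m -> 'M[R[i]]_n) : 'M[R[i]]_(m * n) :=
  \sum_(p < m) \sum_(q < m) delta_mx p q *t Pi (delta_mx p q).

Definition PPT_operation (R : realType) (a b a' b' : nat)
    (Pi : {linear 'M[R[i]]_(a * b) -> 'M[R[i]]_(a' * b')}) : Prop :=
  [/\ completely_positive Pi, trace_preserving Pi & psd (ptransBB (choi Pi))].

Definition max_entangled (R : realType) (k : nat) : 'M[R[i]]_(k * k) :=
  k%:R^-1 *: \sum_(i < k) \sum_(j < k)
    delta_mx (mxtens_index (i, i)) (mxtens_index (j, j)).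

Definition fidelities (R : realType) (a b : nat) (rho : 'M[R[i]]_(a * b))
    (k : nat) : set R :=
  [set x | exists2 Pi : {linear 'M[R[i]]_(a * b) -> 'M[R[i]]_(k * k)},
     PPT_operation Pi & x = rtrace (Pi rho *m max_entangled R k)].

Definition F_PPT (R : realType) (a b : nat) (rho : 'M[R[i]]_(a * b))
    (k : nat) : R := sup (fidelities rho k).

Definition distillable_dims (R : realType) (a b : nat)
    (rho : 'M[R[i]]_(a * b)) (eps : R) : set R :=
  [set x | exists2 k : nat,
     (1 <= k)%N /\ 1 - eps <= F_PPT rho k & x = k%:R].

Definition ED_PPT (R : realType) (a b : nat) (rho : 'M[R[i]]_(a * b))
    (eps : R) : \bar R := log2e (sup (distillable_dims rho eps))%:E.

Definition test_values (R : realType) (n : nat) (rho : 'M[R[i]]_n)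
    (eps : R) (G : 'M[R[i]]_n) : set R :=
  [set x | exists2 M : 'M[R[i]]_n,
     [/\ psd M, psd (1%:M - M) & 1 - rtrace (M *m rho) <= eps]
     & x = rtrace (M *m G)].

Definition DH (R : realType) (n : nat) (rho : 'M[R[i]]_n) (eps : R)
    (G : 'M[R[i]]_n) : \bar R := (- log2e (inf (test_values rho eps G))%:E)%E.

Definition DH_values (R : realType) (a b : nat) (rho : 'M[R[i]]_(a * b))
    (eps : R) : set (\bar R) :=
  [set DH rho eps G | G in [set G : 'M[R[i]]_(a * b) |
     G \is hermsymmx /\ trace_norm (ptransB G) <= 1]].

Definition min_DH (R : realType) (a b : nat) (rho : 'M[R[i]]_(a * b))
    (eps : R) : \bar R := ereal_inf (DH_values rho eps).

Definition log_integer_gaps (R : realType) (D : \bar R) : set R :=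
  [set delta | 0 <= delta <= 1 /\
     exists z : int, (D - delta%:E)%E = log2e (z%:~R)%:E].

(* Main.v *)
(* Following Rains, the fidelities reachable with PPT operations for a given k
   >= 2 are the numbers Tr M rho with 0 <= M <= 1 and -1/k <= M^{T_B} <= 1/k: M is
   the pull-back of Psi_k, and conversely M is realised by measuring {M, 1 - M}
   and preparing Psi_k or the normalised projection onto its complement.  Hence
   k is distillable iff the compact convex set K of tests accepting rho with
   probability at least 1 - eps meets (1/k) C, where C is the unit ball of
   |M^{T_B}|_oo.  The polar of C is the set of G with |G^{T_B}|_1 <= 1, so
   separating K from multiples of C gives a number v such that K meets t C iff
   t >= v, and v is the maximum over G of the minimum over M in K of Tr M G.
   Therefore min D_H = - log v, while the largest distillable k is the integer
   part of 1/v. *)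
Require Import Defs.
From HB Require Import structures.
From mathcomp Require Import all_boot all_order all_algebra.
From mathcomp Require Import all_classical all_reals all_analysis.
From mathcomp.real_closed Require Import complex mxtens.
From mathcomp Require Import ring lra.

Set Implicit Arguments.
Unset Strict Implicit.
Unset Printing Implicit Defensive.

Import Order.TTheory GRing.Theory Num.Theory.
Import numFieldNormedType.Exports.

Local Open Scope classical_set_scope.
Local Open Scope ring_scope.
Local Open Scope sesquilinear_scope.
Local Open Scope complex_scope.

(** The convex analysis takes place in a real Euclidean space: Hermitian matrices receive real
    coordinates in which the trace pairing is the dot product, and positivity becomes a family of
    linear inequalities, one per vector. Separation then needs only the point of a compact convex
    set nearest to the origin. Compactness serves twice: for K and C it makes K - vC compact, and
    for the polar of C it makes an optimal G exist, so that both sides of the duality are attained.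
    The converse half of the correspondence with tests divides by k^2 - 1, the trace of the
    complement of Psi_k; this vanishes at k = 1, which therefore needs its own operation. The
    constant v lies in ]0, 1], so 1/v is finite with integer part k >= 1, and k <= 1/v < k + 1 <= 2k
    is what confines delta to [0, 1]. *)

Section Duality.
Variables (R : realType) (N : nat).
Local Notation V := 'rV[R]_N.
Implicit Types (x y z G : V).

Definition dot x y : R := \sum_i x 0 i * y 0 i.

Lemma dotC x y : dot x y = dot y x.
Proof. by apply: eq_bigr => i _; rewrite mulrC. Qed.

Lemma dotDl x y z : dot (x + y) z = dot x z + dot y z.
Proof. by rewrite -big_split; apply: eq_bigr => i _; rewrite mxE mulrDl. Qed.

Lemma dotZl c x z : dot (c *: x) z = c * dot x z.
Proof. by rewrite mulr_sumr; apply: eq_bigr => i _; rewrite mxE mulrA. Qed.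

Lemma dotBl x y z : dot (x - y) z = dot x z - dot y z.
Proof. by rewrite dotDl -scaleN1r dotZl mulN1r. Qed.

Lemma dotDr x y z : dot x (y + z) = dot x y + dot x z.
Proof. by rewrite dotC dotDl !(dotC x). Qed.

Lemma dotZr c x z : dot x (c *: z) = c * dot x z.
Proof. by rewrite dotC dotZl (dotC x). Qed.

Lemma dotNr x y : dot x (- y) = - dot x y.
Proof. by rewrite -scaleN1r dotZr mulN1r. Qed.

Lemma dot0r x : dot x 0 = 0.
Proof. by rewrite -(scale0r 0) dotZr mul0r. Qed.

Lemma dotxx_ge0 x : 0 <= dot x x.
Proof. by apply: sumr_ge0 => i _; rewrite -expr2 sqr_ge0. Qed.

Lemma dotxx_eq0 x : dot x x = 0 -> x = 0.
Proof.
move=> /eqP; rewrite psumr_eq0 => [/allP h|i _]; last by rewrite -expr2 sqr_ge0.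
apply/rowP => i; have := h i; rewrite mem_index_enum mxE mulf_eq0 orbb.
by move=> /(_ isT) /eqP.
Qed.

Lemma dot_cvg (T : Type) (F : set_system T) {FF : Filter F} (f g : T -> V) x y :
  f @ F --> x -> g @ F --> y -> (fun t => dot (f t) (g t)) @ F --> dot x y.
Proof.
move=> fx gy; rewrite /dot; elim: (index_enum _) => [|i r IH].
  under eq_fun do rewrite big_nil; rewrite big_nil; exact: cvg_cst.
under eq_fun do rewrite big_cons; rewrite big_cons; apply: cvgD => //; apply: cvgM.
- exact: (cvg_comp _ _ fx (@coord_continuous R 1 N 0 i x)).
- exact: (cvg_comp _ _ gy (@coord_continuous R 1 N 0 i y)).
Qed.

Lemma dot_continuous y : continuous (dot^~ y : V -> R).
Proof.
move=> x; apply: (@dot_cvg V (nbhs x) _ id (fun=> y) x y); first exact: cvg_id.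
exact: cvg_cst.
Qed.

Lemma dot_continuousr x : continuous (dot x : V -> R).
Proof.
move=> y; apply: (@dot_cvg V (nbhs y) _ (fun=> x) id x y); last exact: cvg_id.
exact: cvg_cst.
Qed.

(** Positivity is one linear inequality per vector, so the feasible sets below are intersections of
    arbitrary families of half-spaces. This fact and its convex counterpart handle all of them. *)
Lemma closed_halfspaces (I : Type) (n : I -> V) (c : I -> R) :
  closed [set x | forall i, c i <= dot x (n i)].
Proof.
rewrite (_ : [set x | _] = \bigcap_(i in setT) (dot^~ (n i) @^-1` [set r | c i <= r])).
  apply: closed_bigI => i _; apply: closed_comp; last exact: closed_ge.
  by move=> x _; exact: dot_continuous.
by apply/seteqP; split=> [x h i _|x h i]; [exact: h|exact: (h i)].
Qed.

Definition convex (K : set V) := forall x y (t : R), 0 <= t <= 1 ->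
  K x -> K y -> K (t *: x + (1 - t) *: y).

Lemma convex_halfspaces (I : Type) (n : I -> V) (c : I -> R) :
  convex [set x | forall i, c i <= dot x (n i)].
Proof.
move=> x y t /andP[t0 t1] hx hy i; rewrite dotDl !dotZl.
have := ler_wpM2l t0 (hx i); have t1' : 0 <= 1 - t by rewrite subr_ge0.
by have := ler_wpM2l t1' (hy i); lra.
Qed.

(** The normal is the point [G] of [D] nearest to the origin: if some [z] in [D] had
    [dot z G < dot G G], a short move from [G] towards [z] would decrease the norm. *)
Lemma separation_from_0 (D : set V) : D !=set0 -> compact D -> convex D ->
  D 0 \/ exists G, exists2 c, 0 < c & forall z, D z -> c <= dot z G.
Proof.
move=> D0 Dc Dv.
have cf : {within D, continuous (fun z : V => dot z z)}.
  apply: continuous_subspaceT => x.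
  by apply: (@dot_cvg V (nbhs x) _ id id x x); exact: cvg_id.
have [G] := compact_EVT_min D0 Dc cf; rewrite inE => DG Gmin.
have [/eqP G0|G0] := boolP (dot G G == 0).
  by left; rewrite -(dotxx_eq0 G0).
right; exists G; exists (dot G G); first by rewrite lt_def G0 dotxx_ge0.
move=> z Dz; rewrite leNgt; apply/negP => lt_zG.
pose p := dot z G; pose q := dot z z; pose g := dot G G.
have key t : 0 <= t <= 1 ->
  g <= t ^+ 2 * q + 2 * t * (1 - t) * p + (1 - t) ^+ 2 * g.
  move=> t01; have /Gmin : t *: z + (1 - t) *: G \in D by rewrite inE; exact: Dv.
  rewrite dotDl !dotDr !dotZl !dotZr (dotC G z) -/p -/q -/g; lra.
have g0 : 0 <= g by exact: dotxx_ge0.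
have q0 : 0 <= q by exact: dotxx_ge0.
have pg : p < g by [].
(* Minimality forces t(q - 2p + g) >= 2(g - p) for all t in ]0, 1]. Since s >= g - p, the choice t =
   (g - p)/s is admissible; since 2s > q + 2(g - p), it violates that bound. *)
pose s := q + (g - p) + 1.
have s0 : 0 < s by rewrite /s; lra.
pose t := (g - p) / s.
have ts : t * s = g - p by rewrite /t mulfVK // gt_eqF.
have t0 : 0 < t by rewrite divr_gt0 // subr_gt0.
have t1 : t <= 1 by rewrite /t ler_pdivrMr // mul1r /s; lra.
have := key t; rewrite t1 (ltW t0) => /(_ isT) h.
have {}h : 0 <= t * (t * (q - 2 * p + g) - 2 * (g - p)) by lra.
move: h; rewrite pmulr_rge0 // => h.
(* q - 2p + g <= q + 2(g - p) - g, and t s = g - p *)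
have := key 1; rewrite lexx ler01 => /(_ isT) gq.
have tg : 0 <= t * g by rewrite mulr_ge0 // ltW.
have : t * (q - 2 * p + g) <= t * (q + 2 * (g - p)) by apply: ler_wpM2l; lra.
have : t * (q + 2 * (g - p)) = 2 * (t * s) - t * (q + 2) by rewrite /s; ring.
have : 0 < t * (q + 2) by rewrite mulr_gt0 //; lra.
rewrite ts; lra.
Qed.

(* At an optimal G0 with value v, K meets v C: otherwise a hyperplane separating
   K from v C would, after rescaling, improve on G0. *)
Lemma gauge_duality (K C : set V) :
  let B := [set G | forall Y, C Y -> dot Y G <= 1] in
  K !=set0 -> compact K -> convex K -> C 0 -> compact C -> convex C ->
  compact B ->
  exists v : R, [/\ 0 <= v,
    exists2 Y, C Y & K (v *: Y) &
    exists2 G0, B G0 & forall M, K M -> v <= dot M G0].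
Proof.
move=> B [M1 KM1] Kc Kv C0 Cc Cv Bc.
have B0 : B 0 by move=> Y _; rewrite dot0r.
have [Gm _ Gmax] : exists2 G, G \in B & forall t, t \in B -> dot M1 t <= dot M1 G.
  apply: (@compact_EVT_max V R (dot M1)) => //; first by exists 0.
  by apply: continuous_subspaceT => x; exact: dot_continuousr.
pose m := dot M1 Gm.
(* Pairs of a lower bound s and a [G] of the polar whose pairing with [K] stays above s. The cap [m]
   excludes no such s, because s <= [dot M1 G] <= [m], and it makes [E] compact, so that a largest s
   exists. *)
pose E := (`[0, m]%classic `*` B) `&` [set sG : R * V | forall M, K M -> sG.1 <= dot M sG.2].
have Ec : compact E.
  apply: compact_closedI; first by apply: compact_setX => //; exact: segment_compact.
  rewrite (_ : [set sG | _] = \bigcap_(M in K)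
    ((fun sG : R * V => dot M sG.2 - sG.1) @^-1` [set r | 0 <= r])); last first.
    apply/seteqP; split=> [sG h M KM|sG h M KM] /=; first by rewrite subr_ge0; exact: h.
    by have := h M KM; rewrite /= subr_ge0.
  apply: closed_bigI => M _; apply: closed_comp; last exact: closed_ge.
  move=> sG _; apply: cvgB; last exact: cvg_fst.
  apply: (@dot_cvg _ _ _ (fun=> M) snd M sG.2); first exact: cvg_cst.
  exact: cvg_snd.
have m0 : 0 <= m by rewrite -(dot0r M1); apply: Gmax; rewrite inE.
have E0 : E !=set0.
  exists (0, 0); split; first by split => //=; rewrite in_itv /= lexx m0.
  by move=> M _; rewrite dot0r.
have [[v G0]] : exists2 c, c \in E & forall t, t \in E -> t.1 <= c.1.
  apply: (@compact_EVT_max (R * V)%type R fst) => //.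
  by apply: continuous_subspaceT => x; exact: cvg_fst.
rewrite inE => -[[/=]]; rewrite in_itv /= => /andP[v0 _] BG0 vG0 vmax.
exists v; split=> //; last by exists G0.
(* This is K - vC, which contains 0 exactly when K meets vC. *)
pose D := [set MY.1 - v *: MY.2 | MY in K `*` C].
have [] := @separation_from_0 D.
- by exists (M1 - v *: 0), (M1, 0).
- apply: continuous_compact; last exact: compact_setX.
  apply: continuous_subspaceT => x; apply: cvgB; first exact: cvg_fst.
  by apply: cvgZl_tmp; exact: cvg_snd.
- move=> _ _ t t01 [[M Y] [/= KM CY] <-] [[M' Y'] [/= KM' CY'] <-].
  exists (t *: M + (1 - t) *: M', t *: Y + (1 - t) *: Y').
    by split; [exact: Kv|exact: Cv].
  rewrite /= !scalerDr !scalerN !scalerA ![v * _]mulrC opprD -!addrA.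
  by congr (_ + _); rewrite addrCA.
- move=> [[M Y] [/= KM CY]] /eqP; rewrite subr_eq0 => /eqP MY.
  by exists Y; rewrite // -MY.
move=> [G [c c0 Gc]].
have [Y1] : exists2 Y, Y \in C & forall t, t \in C -> dot t G <= dot Y G.
  apply: (@compact_EVT_max V R (dot^~ G)) => //; first by exists 0.
  by apply: continuous_subspaceT => x; exact: dot_continuous.
rewrite inE => CY1 Y1max; pose h := dot Y1 G.
have h0 : 0 <= h by rewrite -(dot0r G) dotC; apply: Y1max; rewrite inE.
have KG M : K M -> c + v * h <= dot M G.
  move=> KM; have : D (M - v *: Y1) by exists (M, Y1).
  by move=> /Gc; rewrite dotBl dotZl -/h; lra.
(* The support value [h] of [C] in direction [G] may be 0, so [G] is divided by h + e. As v e < c,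
   the new value (c + v h)/(h + e) still exceeds v, against maximality. *)
pose e := c / (2 * (v + 1)).
have e0 : 0 < e by rewrite divr_gt0 //; lra.
have ec : e * (2 * (v + 1)) = c by rewrite mulfVK // gt_eqF //; lra.
pose h' := h + e; have h'0 : 0 < h' by rewrite /h'; lra.
have hh : h'^-1 * h' = 1 by rewrite mulVf // gt_eqF.
pose w := (c + v * h) / h'.
have wh : w * h' = c + v * h by rewrite mulfVK // gt_eqF.
have vw : v < w by rewrite ltr_pdivlMr // /h'; lra.
exfalso; suff : E (w, h'^-1 *: G) by move=> Ew; have := vmax (w, h'^-1 *: G); rewrite inE => /(_ Ew) /=; lra.
have wM M : K M -> w <= dot M (h'^-1 *: G).
  by move=> KM; rewrite dotZr mulrC ler_pM2r ?invr_gt0 //; exact: KG.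
have BG : B (h'^-1 *: G).
  move=> Y CY; rewrite dotZr mulrC ler_pdivrMr // mul1r.
  apply: (@le_trans _ _ h); last by rewrite /h'; lra.
  by apply: Y1max; rewrite inE.
split=> //; split => //=; rewrite in_itv /=; apply/andP; split; first lra.
apply: (le_trans (wM _ KM1)); apply: Gmax; rewrite inE; exact: BG.
Qed.

End Duality.

(** * Positive semidefinite complex matrices *)

Section Psd.
Variable R : realType.
Local Notation C := R[i].

Lemma trmxC_mul m n p (A : 'M[C]_(m, n)) (B : 'M[C]_(n, p)) :
  (A *m B)^t* = B^t* *m A^t*.
Proof. by rewrite trmx_mul map_mxM. Qed.

Lemma trmxCD m n (A B : 'M[C]_(m, n)) : (A + B)^t* = A^t* + B^t*.
Proof. by apply/matrixP => i j; rewrite !mxE rmorphD. Qed.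

Lemma trmxCN m n (A : 'M[C]_(m, n)) : (- A)^t* = - A^t*.
Proof. by apply/matrixP => i j; rewrite !mxE rmorphN. Qed.

Lemma trmxCZ m n c (A : 'M[C]_(m, n)) : (c *: A)^t* = Num.conj c *: A^t*.
Proof. by apply/matrixP => i j; rewrite !mxE rmorphM. Qed.

Lemma trmxC1 n : (1%:M : 'M[C]_n)^t* = 1%:M.
Proof. by rewrite trmx1 map_mx1. Qed.

Lemma mxtraceJ n (A : 'M[C]_n) : \tr (A^t*) = Num.conj (\tr A).
Proof. by rewrite rmorph_sum; apply: eq_bigr => i _; rewrite !mxE. Qed.

Lemma hermsymmxP n (A : 'M[C]_n) : reflect (A^t* = A) (A \is hermsymmx).
Proof.
by apply: (iffP (is_hermitianmxP _ _ _)); rewrite expr0 scale1r => /esym.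
Qed.

(** Polarisation: the coefficients 1 and 'i give p + q = 0 and p = q for the two cross terms, hence
    p = 0. *)
Lemma qform_eq0 n (D : 'M[C]_n) :
  (forall v : 'rV[C]_n, (v *m D *m v^t*) 0 0 = 0) -> D = 0.
Proof.
move=> h.
have key (u w : 'rV[C]_n) : (u *m D *m w^t*) 0 0 = 0.
  pose p := (u *m D *m w^t*) 0 0; pose q := (w *m D *m u^t*) 0 0.
  have hp (c : C) : Num.conj c * p + c * q = 0.
    have := h (u + c *: w).
    rewrite trmxCD trmxCZ !mulmxDl !mulmxDr -!scalemxAl -!scalemxAr !mxE.
    have := h u; have := h w; rewrite !mxE => -> ->.
    by rewrite !mulr0 addr0 add0r /p /q !mxE.
  have := hp 1; rewrite conjC1 !mul1r => /eqP; rewrite addr_eq0 => /eqP pq.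
  have := hp 'i%R; rewrite -/p -[q]opprK -pq conjCi mulNr mulrN -opprD.
  by move=> /eqP; rewrite oppr_eq0 -mulr2n mulrn_eq0 /= mulf_eq0 (negPf (neq0Ci _)) => /eqP.
apply/matrixP => i j; rewrite mxE.
have := key (delta_mx 0 i) (delta_mx 0 j).
rewrite -rowE (_ : (delta_mx 0 j)^t* = delta_mx j 0); last first.
  by rewrite trmx_delta map_delta_mx.
by rewrite -colE !mxE.
Qed.

Lemma psd_hermitian n (M : 'M[C]_n) : psd M -> M^t* = M.
Proof.
move=> Mp; apply/eqP; rewrite -subr_eq0; apply/eqP/qform_eq0 => v.
rewrite mulmxBr mulmxBl (_ : v *m M^t* *m v^t* = (v *m M *m v^t*)^t*); last first.
  by rewrite !trmxC_mul trmxCK mulmxA.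
set q := v *m M *m v^t*.
have := Mp v; rewrite -/q; clearbody q => /geC0_conj q0.
by rewrite !mxE [Num.conj _]q0 subrr.
Qed.

Lemma spectral_decomposition n (A : 'M[C]_n) : A^t* = A ->
  exists2 U : 'M[C]_n, U \is unitarymx &
    exists d : 'I_n -> R, A = U^t* *m diag_mx (\row_i (d i)%:C) *m U.
Proof.
move=> Ah; have Ahs : A \is hermsymmx by apply/hermsymmxP.
have Uu := spectral_unitarymx A; exists (spectralmx A) => //.
exists (fun i => complex.Re (spectral_diag A 0 i)).
have /orthomx_spectralP := hermitian_normalmx Ahs; rewrite invmx_unitary // => {1}->.
suff -> : \row_i (complex.Re (spectral_diag A 0 i))%:C = spectral_diag A by [].
apply/rowP => i; rewrite mxE.
have /mxOverP/(_ 0 i) := hermitian_spectral_diag_real Ahs.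
rewrite realE !lecE /= => /orP[] /andP[/eqP].
  by case: (spectral_diag A 0 i) => x y /= ->.
by case: (spectral_diag A 0 i) => x y /= <-.
Qed.

Lemma diag_mx_gram n (d e : 'I_n -> R) : (forall i, e i * e i = d i) ->
  (diag_mx (\row_i (e i)%:C : 'rV[C]_n))^t* *m diag_mx (\row_i (e i)%:C) =
  diag_mx (\row_i (d i)%:C).
Proof.
move=> ed; apply/matrixP => i j; rewrite tr_diag_mx map_diag_mx mulmx_diag !mxE.
case: (i == j); rewrite ?mulr0n // !mulr1n [X in X * _]conjc_real.
by rewrite -rmorphM /= ed.
Qed.

Lemma unitary_conjK n (U A : 'M[C]_n) : U \is unitarymx ->
  U *m (U^t* *m A *m U) *m U^t* = A.
Proof.
by move=> /unitarymxP Uu; rewrite !mulmxA Uu mul1mx -mulmxA Uu mulmx1.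
Qed.

Lemma psd_gram m n (A : 'M[C]_(m, n)) : psd (A^t* *m A).
Proof.
move=> v; rewrite mulmxA -mulmxA (_ : A *m v^t* = (v *m A^t*)^t*); last first.
  by rewrite trmxC_mul trmxCK.
rewrite mxE; apply: sumr_ge0 => i _; rewrite !mxE; exact: mulcJ_ge0.
Qed.

Lemma psd_conj m n (A : 'M[C]_(m, n)) (M : 'M[C]_n) : psd M -> psd (A *m M *m A^t*).
Proof. by move=> Mp v; have := Mp (v *m A); rewrite trmxC_mul !mulmxA. Qed.

Lemma qform_delta n (M : 'M[C]_n) i :
  ((delta_mx 0 i : 'rV[C]_n) *m M *m (delta_mx 0 i : 'rV[C]_n)^t*) 0 0 = M i i.
Proof. by rewrite -rowE trmx_delta map_delta_mx -colE !mxE. Qed.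

Lemma psd_diag_ge0 n (M : 'M[C]_n) i : psd M -> 0 <= M i i.
Proof. by move=> /(_ (delta_mx 0 i)); rewrite qform_delta. Qed.

Lemma psd_diag_mx n (d : 'I_n -> C) : (forall i, 0 <= d i) ->
  psd (diag_mx (\row_i d i)).
Proof.
move=> d0 v; rewrite mul_mx_diag mxE; apply: sumr_ge0 => i _; rewrite !mxE.
by rewrite mulrAC mulr_ge0 //; exact: mulcJ_ge0.
Qed.

Lemma psd_sqrt n (M : 'M[C]_n) : psd M -> exists A : 'M[C]_n, M = A^t* *m A.
Proof.
move=> Mp; have [U Uu [d Md]] := spectral_decomposition (psd_hermitian Mp).
have d0 i : 0 <= d i.
  have := psd_diag_ge0 i (psd_conj U Mp).
  by rewrite Md unitary_conjK // !mxE eqxx mulr1n ler0c.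
pose D : 'M[C]_n := diag_mx (\row_i (Num.sqrt (d i))%:C).
have DD : D^t* *m D = diag_mx (\row_i (d i)%:C).
  by apply: diag_mx_gram => i; rewrite -expr2 sqr_sqrtr.
by exists (D *m U); rewrite trmxC_mul mulmxA -[_ *m D^t* *m D]mulmxA DD.
Qed.

Lemma psd_mulmx_tr_ge0 n (M Z : 'M[C]_n) : psd M -> psd Z -> 0 <= \tr (M *m Z).
Proof.
move=> Mp /psd_sqrt[A ->]; rewrite mulmxA mxtrace_mulC mulmxA.
by apply: sumr_ge0 => i _; apply: psd_diag_ge0; exact: psd_conj.
Qed.

Lemma psdD n (A B : 'M[C]_n) : psd A -> psd B -> psd (A + B).
Proof. by move=> Ap Bp v; rewrite mulmxDr mulmxDl mxE addr_ge0. Qed.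

Lemma psdZ n c (A : 'M[C]_n) : 0 <= c -> psd A -> psd (c *: A).
Proof. by move=> c0 Ap v; rewrite -scalemxAr -scalemxAl mxE mulr_ge0. Qed.

Lemma psd1 n : psd (1%:M : 'M[C]_n).
Proof. by have := psd_gram (1%:M : 'M[C]_n); rewrite trmxC1 mulmx1. Qed.

Lemma psd0 n : psd (0 : 'M[C]_n).
Proof. by move=> v; rewrite mulmx0 mul0mx mxE. Qed.

Lemma psd_trmx n (A : 'M[C]_n) : psd A -> psd A^T.
Proof.
move=> Ap v; have := Ap (map_mx Num.conj v).
have -> : (map_mx Num.conj v)^t* = v^T.
  by apply/matrixP => i j; rewrite !mxE conjCK.
have -> : v *m A^T *m v^t* = (map_mx Num.conj v *m A *m v^T)^T.
  by rewrite !trmx_mul trmxK map_trmx mulmxA.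
by rewrite [in X in _ -> X]mxE.
Qed.

Lemma psd_tens m n (A : 'M[C]_m) (B : 'M[C]_n) : psd A -> psd B -> psd (A *t B).
Proof.
move=> /psd_sqrt[A' ->] /psd_sqrt[B' ->].
rewrite -tensmx_mul -map_mxT -trmx_tens; exact: psd_gram.
Qed.

Lemma qform_trE n (M : 'M[C]_n) (v : 'rV[C]_n) :
  (v *m M *m v^t*) 0 0 = \tr (M *m (v^t* *m v)).
Proof. by rewrite mulmxA mxtrace_mulC mulmxA trace_mx11. Qed.

Lemma psd_tr n (M : 'M[C]_n) :
  psd M <-> forall v : 'rV[C]_n, 0 <= \tr (M *m (v^t* *m v)).
Proof. by split=> h v; [rewrite -qform_trE|rewrite qform_trE]; exact: h. Qed.

Lemma herm_tr_real n (A B : 'M[C]_n) : A^t* = A -> B^t* = B ->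
  \tr (A *m B) = (rtrace (A *m B))%:C.
Proof.
move=> Ah Bh; have : Num.conj (\tr (A *m B)) = \tr (A *m B).
  by rewrite -mxtraceJ trmxC_mul Ah Bh mxtrace_mulC.
rewrite /rtrace; case: (\tr _) => x y /eqP; rewrite eq_complex /= => /andP[_].
by rewrite eq_sym -addr_eq0 -mulr2n mulrn_eq0 /= => /eqP ->.
Qed.

Lemma rtraceD n (A B : 'M[C]_n) : rtrace (A + B) = rtrace A + rtrace B.
Proof. by rewrite /rtrace mxtraceD; case: (\tr A) (\tr B) => ? ? [? ?]. Qed.

Lemma rtraceN n (A : 'M[C]_n) : rtrace (- A) = - rtrace A.
Proof. by rewrite /rtrace raddfN /=; case: (\tr A). Qed.

Lemma rtrace_ge0 n (M : 'M[C]_n) : 0 <= \tr M -> 0 <= rtrace M.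
Proof. by rewrite lecE /= => /andP[]. Qed.

End Psd.

(** * The trace norm and its duality with the operator norm *)

Section TraceNorm.
Variable R : realType.
Local Notation C := R[i].

Lemma char_poly_unitary n (U D : 'M[C]_n) : U \is unitarymx ->
  char_poly (U^t* *m D *m U) = char_poly D.
Proof.
move=> Uu; have UU : U^t* *m U = 1%:M.
  by apply: mulmx1C; apply/unitarymxP.
pose P (A : 'M[C]_n) := map_mx (@polyC C) A.
have PP : P (U^t* ) *m P U = 1%:M by rewrite -map_mxM UU map_mx1.
rewrite /char_poly /char_poly_mx.
have -> : 'X%:M - P (U^t* *m D *m U) = P (U^t* ) *m ('X%:M - P D) *m P U.
  rewrite mulmxBr mulmxBl scalar_mxC -[_%:M *m _ *m _]mulmxA PP mulmx1.
  by rewrite /P !map_mxM.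
by rewrite !det_mulmx mulrAC -det_mulmx PP det1 mul1r.
Qed.

Lemma char_poly_diag n (d : 'rV[C]_n) :
  char_poly (diag_mx d) = \prod_(x <- [seq d 0 i | i : 'I_n]) ('X - x%:P).
Proof.
rewrite char_poly_trig ?diag_mx_is_trig // big_map big_enum.
by apply: eq_bigr => i _; rewrite mxE eqxx mulr1n.
Qed.

(** The diagonalisation chosen by [spectral_diag] and the given one share a characteristic
    polynomial, so their eigenvalue lists are permutations of each other and any sum over
    eigenvalues agrees. *)
Lemma trace_norm_spectral n (U : 'M[C]_n) (d : 'I_n -> R) : U \is unitarymx ->
  trace_norm (U^t* *m diag_mx (\row_i (d i)%:C) *m U) = \sum_i `|d i|.
Proof.
move=> Uu; set A := _ *m U.
have AA : A^t* *m A = U^t* *m diag_mx (\row_i (d i ^+ 2)%:C) *m U.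
  rewrite /A; set D := diag_mx _; rewrite !trmxC_mul trmxCK !mulmxA.
  rewrite -[_ *m U *m U^t*]mulmxA (unitarymxP Uu) mulmx1.
  rewrite -[_ *m D^t* *m D]mulmxA /D (diag_mx_gram (d := fun i => d i ^+ 2)) //.
have ANn : A^t* *m A \is normalmx.
  by apply/hermitian_normalmx/hermsymmxP; rewrite trmxC_mul trmxCK.
have /orthomx_spectralP := ANn.
rewrite invmx_unitary ?spectral_unitarymx // => /(congr1 char_poly).
rewrite {1}AA !char_poly_unitary ?spectral_unitarymx // !char_poly_diag.
move=> /prod_XsubC_eq pe.
pose f (z : C) := Num.sqrt (complex.Re z).
rewrite /trace_norm.
transitivity (\sum_(z <- [seq spectral_diag (A^t* *m A) 0 i | i : 'I_n]) f z).
  by rewrite big_map big_enum.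
rewrite -(perm_big _ pe) big_map big_enum /=; apply: eq_bigr => i _.
by rewrite /f mxE /= sqrtr_sqr.
Qed.

Lemma tr_unitary_diag n (U Y : 'M[C]_n) (d : 'I_n -> C) :
  \tr (Y *m (U^t* *m diag_mx (\row_i d i) *m U)) =
  \sum_i (U *m Y *m U^t*) i i * d i.
Proof.
rewrite mulmxA mxtrace_mulC !mulmxA mul_mx_diag.
by apply: eq_bigr => i _; rewrite !mxE.
Qed.

(** In an eigenbasis of A, the condition -1 <= Y <= 1 puts the real parts of the diagonal entries of
    Y in [-1, 1]. The bound is attained at the sign of A, obtained by replacing each eigenvalue by
    its sign. *)
Lemma trace_norm_le1P n (A : 'M[C]_n) : A^t* = A ->
  trace_norm A <= 1 <->
  forall Y, psd (1%:M - Y) -> psd (1%:M + Y) -> rtrace (Y *m A) <= 1.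
Proof.
move=> Ah; have [U Uu [d ->]] := spectral_decomposition Ah.
have UU : U^t* *m U = 1%:M by apply: mulmx1C; apply/unitarymxP.
rewrite trace_norm_spectral //; split=> [le1 Y Ym Yp|/(_ (U^t* *m diag_mx (\row_i (Num.sg (d i))%:C) *m U))].
  apply: le_trans le1; rewrite /rtrace tr_unitary_diag raddf_sum /=.
  apply: ler_sum => i _.
  have := psd_diag_ge0 i (psd_conj U Ym); have := psd_diag_ge0 i (psd_conj U Yp).
  rewrite mulmxBr mulmxDr mulmxBl mulmxDl !mulmx1 (unitarymxP Uu) !mxE eqxx.
  case: (\sum_j _) => x y; rewrite !lecE /= mulr0 subr0 => /andP[_ h1] /andP[_ h2].
  have : `|x| <= 1 by rewrite ler_norml; apply/andP; split; lra.
  move=> x1; apply: le_trans (ler_norm _) _; rewrite normrM.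
  by rewrite ler_piMl.
have sp (e : R) : `|e| = 1 -> psd (1%:M + e%:C *: (U^t* *m diag_mx (\row_i (Num.sg (d i))%:C) *m U)).
  move=> e1; have -> : 1%:M + e%:C *: (U^t* *m diag_mx (\row_i (Num.sg (d i))%:C) *m U)
      = U^t* *m diag_mx (\row_i (1 + e * Num.sg (d i))%:C) *m U.
    rewrite -{1}UU -[X in X *m U + _]mulmx1 scalemxAl scalemxAr -mulmxDl -mulmxDr.
    suff -> : 1%:M + e%:C *: diag_mx (\row_i (Num.sg (d i))%:C) =
      diag_mx (\row_i (1 + e * Num.sg (d i))%:C) by [].
    apply/matrixP => i j; rewrite !mxE.
    by case: (i == j); rewrite ?mulr0n ?mulr0 ?addr0 // !mulr1n rmorphD rmorphM.
  rewrite -[X in _ *m X](trmxCK U); apply: psd_conj; apply: psd_diag_mx => i.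
  rewrite ler0c; have : `|e * Num.sg (d i)| <= 1.
    by rewrite normrM e1 mul1r normr_sg; case: (_ != _).
  by rewrite ler_norml => /andP[]; lra.
have := sp (-1); have := sp 1; rewrite normrN1 normr1 !rmorphN !rmorph1 scaleN1r scale1r.
move=> /(_ erefl) h1 /(_ erefl) h2 /(_ h2 h1); rewrite /rtrace tr_unitary_diag raddf_sum /=.
rewrite unitary_conjK //; congr (_ <= 1); apply: eq_bigr => i _.
by rewrite !mxE eqxx mulr1n -rmorphM /= -normrEsg.
Qed.

End TraceNorm.

(** * Hermitian matrices as a Euclidean space, and the partial transpose *)

Section HermitianCoordinates.
Variables (R : realType).
Local Notation C := R[i].

Section Coordinates.
Variable n : nat.
Implicit Types (x y : 'rV[R]_(n * n)) (H : 'M[C]_n).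

(* The real matrix X stands for the Hermitian matrix
   (X + X^T) / 2 + 'i (X - X^T) / 2, which makes [dot] the trace pairing. *)
Definition hmx x : 'M[C]_n := \matrix_(i, j)
  (((vec_mx x i j + vec_mx x j i) / 2) +i* ((vec_mx x i j - vec_mx x j i) / 2)).

Definition hvec H : 'rV[R]_(n * n) :=
  mxvec (\matrix_(i, j) (complex.Re (H i j) + complex.Im (H i j))).

Lemma hmx_hermitian x : (hmx x)^t* = hmx x.
Proof.
apply/matrixP => i j; rewrite !mxE; apply/eqP; rewrite eq_complex /=.
by rewrite addrC eqxx /= -mulNr opprB eqxx.
Qed.

Lemma hvecK H : H^t* = H -> hmx (hvec H) = H.
Proof.
move=> Hh; apply/matrixP => i j; rewrite mxE mxvecK !mxE.
have : H j i = Num.conj (H i j) by rewrite -{1}Hh !mxE.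
move=> ->; case: (H i j) => u v /=; congr (_ +i* _); lra.
Qed.

Lemma hmxK x : hvec (hmx x) = x.
Proof.
rewrite -[RHS]vec_mxK; congr mxvec; apply/matrixP => i j; rewrite !mxE /=; lra.
Qed.

Lemma hmxZ c x : hmx (c *: x) = c%:C *: hmx x.
Proof.
apply/matrixP => i j; rewrite !mxE; apply/eqP; rewrite eq_complex /=.
by apply/andP; split; apply/eqP; lra.
Qed.

Lemma rtrace_hmx x H : H^t* = H -> rtrace (hmx x *m H) = dot x (hvec H).
Proof.
move=> Hh; pose X := vec_mx x.
pose a i j := complex.Re (H i j); pose b i j := complex.Im (H i j).
have aT i j : a j i = a i j by rewrite /a -{1}Hh !mxE; case: (H i j).
have bT i j : b j i = - b i j by rewrite /b -{1}Hh !mxE; case: (H i j).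
transitivity (\sum_i \sum_j X i j * (a i j + b i j)); last first.
  rewrite /dot pair_big /= (reindex _ (curry_mxvec_bij n n)) /=.
  by apply: eq_bigr => -[i j] _; rewrite /hvec mxvecE !mxE.
rewrite /rtrace raddf_sum /=.
transitivity (\sum_i \sum_j ((X i j + X j i) / 2 * a i j + (X i j - X j i) / 2 * b i j)).
  apply: eq_bigr => i _; rewrite mxE raddf_sum; apply: eq_bigr => j _.
  rewrite !mxE -/X -[H j i]/(H j i) /=.
  have -> : H j i = a i j +i* - b i j by rewrite -aT -bT /a /b; case: (H j i).
  by rewrite /= mulrN opprK.
have split2 (f g : 'I_n -> 'I_n -> R) :
    \sum_i \sum_j (f i j + g i j) = \sum_i \sum_j f i j + \sum_i \sum_j g i j.
  by rewrite -big_split; apply: eq_bigr => i _; rewrite big_split.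
transitivity (\sum_i \sum_j (X i j * (a i j + b i j) / 2 + X j i * (a i j - b i j) / 2)).
  by apply: eq_bigr => i _; apply: eq_bigr => j _; lra.
(* Once i and j are exchanged in the second half, the symmetry of [a] and the antisymmetry of [b]
   make both halves equal. *)
rewrite split2 [X in _ + X]exchange_big -split2 /=.
by apply: eq_bigr => i _; apply: eq_bigr => j _; rewrite aT bT; lra.
Qed.

Lemma dot_hmx x y : dot x y = rtrace (hmx x *m hmx y).
Proof. by rewrite rtrace_hmx ?hmxK //; exact: hmx_hermitian. Qed.

Lemma rankone_hermitian (v : 'rV[C]_n) : (v^t* *m v)^t* = v^t* *m v.
Proof. by rewrite trmxC_mul trmxCK. Qed.

Lemma psd_rtraceP H : H^t* = H ->
  psd H <-> forall v : 'rV[C]_n, 0 <= rtrace (H *m (v^t* *m v)).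
Proof.
move=> Hh; rewrite psd_tr; split=> h v; have := h v.
  exact: rtrace_ge0.
by rewrite herm_tr_real // ?ler0c //; exact: rankone_hermitian.
Qed.

End Coordinates.

(** A partial transpose permutes matrix positions by an involution, so reindexing moves it across
    the trace pairing. The abstract [s] covers both [ptransB] and [ptransBB]. *)
Lemma tr_entry_swap N (s : 'I_N -> 'I_N -> 'I_N) (X Y : 'M[C]_N) :
  (forall p q, s (s p q) (s q p) = p) ->
  \tr ((\matrix_(p, q) X (s p q) (s q p)) *m Y) =
  \tr (X *m \matrix_(p, q) Y (s p q) (s q p)).
Proof.
move=> sK.
transitivity (\sum_p \sum_q X (s p q) (s q p) * Y q p).
  by apply: eq_bigr => p _; rewrite mxE; apply: eq_bigr => q _; rewrite mxE.
transitivity (\sum_p \sum_q X p q * Y (s q p) (s p q)); last first.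
  by apply: eq_bigr => p _; rewrite [RHS]mxE; apply: eq_bigr => q _; rewrite [in RHS]mxE.
rewrite !pair_big /=.
pose f (u : 'I_N * 'I_N) := (s u.1 u.2, s u.2 u.1).
have fK : involutive f by move=> [p q]; rewrite /f /= !sK.
rewrite [RHS](reindex_inj (inv_inj fK)) /=.
by apply: eq_bigr => -[p q] _; rewrite /f /= !sK.
Qed.

Section PartialTranspose.
Variables a b : nat.
Local Notation N := (a * b)%N.
Implicit Types (X Y : 'M[C]_N).

Lemma swap_sndK (p q : 'I_N) : swap_snd (swap_snd p q) (swap_snd q p) = p.
Proof.
case: (mxtens_indexP p) => p1 p2; case: (mxtens_indexP q) => q1 q2.
by rewrite /swap_snd !mxtens_indexK.
Qed.

Lemma ptransBK X : ptransB (ptransB X) = X.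
Proof. by apply/matrixP => p q; rewrite !mxE !swap_sndK. Qed.

Lemma ptransBD X Y : ptransB (X + Y) = ptransB X + ptransB Y.
Proof. by apply/matrixP => p q; rewrite !mxE. Qed.

Lemma ptransBN X : ptransB (- X) = - ptransB X.
Proof. by apply/matrixP => p q; rewrite !mxE. Qed.

Lemma ptransBZ c X : ptransB (c *: X) = c *: ptransB X.
Proof. by apply/matrixP => p q; rewrite !mxE. Qed.

Lemma swap_snd_eq (p q : 'I_N) : (swap_snd p q == swap_snd q p) = (p == q).
Proof.
apply/eqP/eqP => [e|->] //.
move: (swap_sndK p q) (swap_sndK q p); rewrite e => hp hq.
exact: etrans (esym hp) hq.
Qed.

Lemma ptransB1 : ptransB (1%:M : 'M[C]_N) = 1%:M.
Proof. by apply/matrixP => p q; rewrite !mxE swap_snd_eq. Qed.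

Lemma ptransB_trmxC X : (ptransB X)^t* = ptransB (X^t* ).
Proof. by apply/matrixP => p q; rewrite !mxE. Qed.

Lemma mxtrace_ptransB X : \tr (ptransB X) = \tr X.
Proof.
apply: eq_bigr => p _; rewrite mxE; congr (X _ _);
by case: (mxtens_indexP p) => p1 p2; rewrite /swap_snd !mxtens_indexK.
Qed.

Lemma tr_ptransB_mul X Y : \tr (ptransB X *m Y) = \tr (X *m ptransB Y).
Proof. by apply: (@tr_entry_swap _ (@swap_snd a b)) => p q; exact: swap_sndK. Qed.

End PartialTranspose.

Lemma compact_dot_bounded N (c : R) (S : set 'rV[R]_N) :
  closed S -> (forall x, S x -> dot x x <= c) -> compact S.
Proof.
move=> Sc Sb.
have [c0|c0] := ltP c 0.
  rewrite (_ : S = set0); first exact: compact0.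
  by rewrite -subset0 => x /Sb; have := dotxx_ge0 x; lra.
rewrite (_ : S = [set x : 'rV[R]_N | forall i, `[- (c + 1), c + 1]%classic (x ord0 i)] `&` S).
  apply: compact_closedI => //; apply: (@rV_compact R N (fun=> `[- (c + 1), c + 1]%classic)) => i.
  exact: segment_compact.
apply/seteqP; split=> [x Sx|x []//]; split=> // i.
rewrite /= in_itv /=.
have : x 0 i * x 0 i <= c.
  apply: le_trans (Sb x Sx); rewrite /dot (bigD1 i) //= lerDl.
  by apply: sumr_ge0 => j _; rewrite -expr2 sqr_ge0.
move: (x 0 i) => t tc; apply/andP; split; nra.
Qed.

End HermitianCoordinates.

(** * Tensor products, Choi matrices and measure-and-prepare maps *)

Section Tensor.
Variable R : realType.
Local Notation C := R[i].

Lemma sum_mxtens (V : nmodType) m n (F : 'I_(m * n) -> V) :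
  \sum_p F p = \sum_i \sum_j F (mxtens_index (i, j)).
Proof.
rewrite pair_big /= (reindex (@mxtens_index m n)) /=.
  by apply: eq_bigr => -[i j] _.
by exists (@mxtens_unindex m n) => p _; [exact: mxtens_indexK|exact: mxtens_unindexK].
Qed.

Lemma mxtrace_tens m n (A : 'M[C]_m) (B : 'M[C]_n) : \tr (A *t B) = \tr A * \tr B.
Proof.
rewrite /mxtrace sum_mxtens mulr_suml; apply: eq_bigr => i _.
by rewrite mulr_sumr; apply: eq_bigr => j _; rewrite tensmxE.
Qed.

Lemma tens_suml m n p q (I : finType) (F : I -> 'M[C]_(m, n)) (B : 'M[C]_(p, q)) :
  (\sum_i F i) *t B = \sum_i F i *t B.
Proof.
by apply/matrixP => r s; rewrite !(mxE, summxE) mulr_suml; apply: eq_bigr => i _; rewrite mxE.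
Qed.

Lemma tensZl m n p q c (A : 'M[C]_(m, n)) (B : 'M[C]_(p, q)) :
  (c *: A) *t B = c *: (A *t B).
Proof. by apply/matrixP => r s; rewrite !mxE mulrA. Qed.

Lemma tensZr m n p q c (A : 'M[C]_(m, n)) (B : 'M[C]_(p, q)) :
  A *t (c *: B) = c *: (A *t B).
Proof. by apply/matrixP => r s; rewrite !mxE mulrCA. Qed.

Section Choi.
Variables m n : nat.
Implicit Types (Pi : {linear 'M[C]_m -> 'M[C]_n}) (Z : 'M[C]_m) (V : 'M[C]_n).

(** Converts positivity of a Choi matrix, or of its partial transpose, into positivity of numbers Tr
    Pi(Z) V. *)
Lemma tr_choi_tens Pi Z V : \tr (choi Pi *m (Z^T *t V)) = \tr (Pi Z *m V).
Proof.
rewrite /choi mulmx_suml raddf_sum [in RHS](matrix_sum_delta Z) linear_sum mulmx_suml raddf_sum.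
apply: eq_bigr => p _; rewrite mulmx_suml raddf_sum linear_sum mulmx_suml raddf_sum.
apply: eq_bigr => q _ /=.
rewrite tensmx_mul mxtrace_tens linearZ /= -scalemxAl mxtraceZ; congr (_ * _).
rewrite -[delta_mx p q](mul_delta_mx (0 : 'I_1)) -mulmxA mxtrace_mulC -rowE -colE.
by rewrite trace_mx11 !mxE.
Qed.

(** The matrix on the left is the Heisenberg picture of V, its image under the adjoint of Pi. *)
Lemma tr_adjoint_mul Pi V Z :
  \tr (\matrix_(p, q) \tr (Pi (delta_mx q p) *m V) *m Z) = \tr (Pi Z *m V).
Proof.
transitivity (\sum_p \sum_q Z p q * \tr (Pi (delta_mx p q) *m V)).
  rewrite exchange_big; apply: eq_bigr => q _.
  by rewrite mxE; apply: eq_bigr => p _; rewrite mulrC mxE.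
rewrite [in RHS](matrix_sum_delta Z) linear_sum mulmx_suml raddf_sum.
apply: eq_bigr => p _; rewrite linear_sum mulmx_suml raddf_sum.
by apply: eq_bigr => q _; rewrite /= linearZ /= -scalemxAl mxtraceZ.
Qed.

(** An ancilla of dimension 1 suffices; the conclusion, obtained in dimension [1 * n], returns to
    dimension [n] by pairing with rank-one matrices. *)
Lemma positive_of_completely_positive Pi Z : completely_positive Pi ->
  psd Z -> psd (Pi Z).
Proof.
move=> cp Zp; have := cp 1%N _ (psd_tens (@psd1 R 1) Zp).
have -> : ampliation Pi ((1%:M : 'M[C]_1) *t Z) = (1%:M : 'M[C]_1) *t Pi Z.
  apply/matrixP => p q; rewrite !mxE !ord1 eqxx mul1r.
  congr (Pi _ _ _); apply/matrixP => r s.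
  by rewrite !mxE !mxtens_indexK !ord1 eqxx mul1r.
move=> Wp; apply/psd_tr => v.
have := psd_mulmx_tr_ge0 Wp (psd_tens (@psd1 R 1) (psd_gram v)).
by rewrite tensmx_mul mxtrace_tens mulmx1 mxtrace1 mul1r.
Qed.

(** One branch of a measure-and-prepare channel: outcome M of the measurement triggers the output
    P. *)
Definition mprep (M : 'M[C]_m) (P : 'M[C]_n) (X : 'M[C]_m) : 'M[C]_n :=
  \tr (M *m X) *: P.

Lemma mprep_is_linear M P : linear (mprep M P).
Proof.
move=> c X Y; rewrite /mprep mulmxDr -scalemxAr mxtraceD mxtraceZ scalerDl.
by rewrite scalerA.
Qed.

HB.instance Definition _ M P :=
  GRing.isLinear.Build C 'M[C]_m 'M[C]_n _ (mprep M P) (mprep_is_linear M P).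

(** The ampliation sends X to XM tensor P, where XM is the partial trace of X against M. Pairing XM
    with a rank-one matrix amounts to pairing X with its tensor product with M, so XM is
    positive. *)
Lemma mprep_completely_positive M P : psd M -> psd P ->
  completely_positive (mprep M P).
Proof.
move=> Mp Pp d X Xp.
pose XM := \matrix_(i < d, j < d)
  \tr (M *m \matrix_(r < m, s < m) X (mxtens_index (i, r)) (mxtens_index (j, s))).
have -> : ampliation (mprep M P) X = XM *t P.
  by apply/matrixP => p q; rewrite !mxE.
apply: psd_tens => //; apply/psd_tr => v.
rewrite (_ : \tr _ = \tr (X *m ((v^t* *m v) *t M))).
  exact: psd_mulmx_tr_ge0 (psd_tens (psd_gram v) Mp).
rewrite [RHS]/mxtrace sum_mxtens; apply: eq_bigr => i _.
rewrite mxE; transitivity (\sum_j \sum_r \sum_s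
  X (mxtens_index (i, r)) (mxtens_index (j, s)) * ((v^t* *m v) j i * M s r)).
  apply: eq_bigr => j _; rewrite !mxE mulr_suml exchange_big /=.
  apply: eq_bigr => s _; rewrite mxE mulr_suml; apply: eq_bigr => r _.
  by rewrite !mxE; ring.
rewrite exchange_big /=; apply: eq_bigr => r _.
rewrite mxE sum_mxtens; apply: eq_bigr => j _; apply: eq_bigr => s _.
by rewrite tensmxE.
Qed.

Lemma choi_mprep M P : choi (mprep M P) = M^T *t P.
Proof.
rewrite /choi [M^T]matrix_sum_delta tens_suml; apply: eq_bigr => p _.
rewrite tens_suml; apply: eq_bigr => q _.
rewrite /mprep tensZr tensZl; congr (_ *: _).
rewrite -[delta_mx p q](mul_delta_mx (0 : 'I_1)) mulmxA mxtrace_mulC mulmxA -rowE -colE.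
by rewrite trace_mx11 !mxE.
Qed.

End Choi.

Lemma choiD m n (f g : 'M[C]_m -> 'M[C]_n) : choi (f \+ g) = choi f + choi g.
Proof.
rewrite /choi -big_split; apply: eq_bigr => p _; rewrite -big_split.
apply: eq_bigr => q _; by apply/matrixP => r s; rewrite !mxE mulrDr.
Qed.

Lemma ampliationD m n d (f g : 'M[C]_m -> 'M[C]_n) (X : 'M[C]_(d * m)) :
  ampliation (f \+ g) X = ampliation f X + ampliation g X.
Proof. by apply/matrixP => p q; rewrite !mxE. Qed.

Section BipartiteTranspose.
Variables a b a' b' : nat.

Lemma ptransBB_tens (A : 'M[C]_(a * b)) (B : 'M[C]_(a' * b')) :
  ptransBB (A *t B) = ptransB A *t ptransB B.
Proof. by apply/matrixP => p q; rewrite !mxE !mxtens_indexK. Qed.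

Lemma ptransBBD (X Y : 'M[C]_((a * b) * (a' * b'))) :
  ptransBB (X + Y) = ptransBB X + ptransBB Y.
Proof. by apply/matrixP => p q; rewrite !mxE. Qed.

Lemma tr_ptransBB_mul (X Y : 'M[C]_((a * b) * (a' * b'))) :
  \tr (ptransBB X *m Y) = \tr (X *m ptransBB Y).
Proof.
apply: (@tr_entry_swap R _ (fun p q : 'I_((a * b) * (a' * b')) =>
  mxtens_index (swap_snd (mxtens_unindex p).1 (mxtens_unindex q).1,
                swap_snd (mxtens_unindex p).2 (mxtens_unindex q).2))) => p q.
case: (mxtens_indexP p) => p1 p2; case: (mxtens_indexP q) => q1 q2.
by rewrite !mxtens_indexK !swap_sndK.
Qed.

Lemma ptransB_trmx (A : 'M[C]_(a * b)) : ptransB A^T = (ptransB A)^T.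
Proof. by apply/matrixP => p q; rewrite !mxE. Qed.

(* Says that Pi conjugated by the partial transpositions is a positive map: its
   Choi matrix is the partial transpose of that of Pi. *)
Lemma PPT_tr_ge0 (Pi : {linear 'M[C]_(a * b) -> 'M[C]_(a' * b')}) Z V :
  PPT_operation Pi -> psd (ptransB Z) -> psd (ptransB V) -> 0 <= \tr (Pi Z *m V).
Proof.
move=> [_ _ ppt] Zp Vp.
rewrite -tr_choi_tens -[Z]ptransBK -[V]ptransBK -ptransB_trmx -ptransBB_tens.
rewrite -tr_ptransBB_mul.
exact: (psd_mulmx_tr_ge0 ppt (psd_tens (psd_trmx Zp) Vp)).
Qed.

End BipartiteTranspose.

End Tensor.

(** * The maximally entangled state, and PPT operations versus tests *)

Section Rains.
Variable R : realType.
Local Notation C := R[i].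

Section MaxEntangled.
Variable k : nat.
Hypothesis k_gt0 : (0 < k)%N.
Local Notation Psi := (max_entangled R k).

Let k_neq0 : k%:R != 0 :> C.
Proof. by rewrite pnatr_eq0 -lt0n. Qed.

Let w : 'rV[C]_(k * k) :=
  \row_p ((mxtens_unindex p).1 == (mxtens_unindex p).2)%:R.

Lemma max_entangled_rankone : Psi = k%:R^-1 *: (w^t* *m w).
Proof.
congr (_ *: _).
have -> : w = \sum_(i < k) delta_mx 0 (mxtens_index (i, i)).
  apply/rowP => p; case: (mxtens_indexP p) => p1 p2.
  rewrite mxE summxE !mxtens_indexK /= (bigD1 p1) //= big1 ?addr0.
    rewrite mxE (can_eq (@mxtens_indexK k k)) xpair_eqE !eqxx /=.
    by rewrite eq_sym.
  move=> i ip; rewrite mxE (can_eq (@mxtens_indexK k k)) xpair_eqE.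
  by rewrite [p1 == i]eq_sym (negPf ip).
have -> : (\sum_(i < k) delta_mx 0 (mxtens_index (i, i)) : 'rV[C]_(k * k))^t* =
    \sum_(i < k) delta_mx (mxtens_index (i, i)) 0.
  rewrite raddf_sum /= map_mx_sum; apply: eq_bigr => i _.
  by rewrite trmx_delta map_delta_mx.
rewrite mulmx_suml; apply: eq_bigr => i _; rewrite mulmx_sumr.
by apply: eq_bigr => j _; rewrite mul_delta_mx.
Qed.

Let w_norm : (w *m w^t*) 0 0 = k%:R.
Proof.
rewrite mxE sum_mxtens [RHS](_ : _ = \sum_(i < k) 1).
  apply: eq_bigr => i _; rewrite (bigD1 i) //= big1 ?addr0.
    by rewrite !mxE !mxtens_indexK /= eqxx conjC1 mulr1.
  by move=> j ji; rewrite !mxE !mxtens_indexK /= [i == j]eq_sym (negPf ji) mul0r.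
by rewrite sumr_const card_ord.
Qed.

Lemma max_entangled_hermitian : Psi^t* = Psi.
Proof.
rewrite max_entangled_rankone trmxCZ trmxC_mul trmxCK; congr (_ *: _).
by rewrite fmorphV rmorph_nat.
Qed.

Lemma max_entangled_proj : Psi *m Psi = Psi.
Proof.
rewrite max_entangled_rankone -scalemxAl -scalemxAr -mulmxA [w *m (_ *m _)]mulmxA.
rewrite [w *m _]mx11_scalar.
by rewrite w_norm mul_scalar_mx -[_ *m (_ *: _)]scalemxAr scalerA (mulVf k_neq0) scale1r.
Qed.

Lemma max_entangled_tr : \tr Psi = 1.
Proof.
rewrite max_entangled_rankone mxtraceZ mxtrace_mulC trace_mx11.
by rewrite w_norm mulVf.
Qed.

Lemma max_entangled_psd : psd Psi.
Proof.
rewrite -max_entangled_proj -{1}max_entangled_hermitian; exact: psd_gram.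
Qed.

Lemma max_entangled_compl_psd : psd (1%:M - Psi).
Proof.
suff -> : 1%:M - Psi = (1%:M - Psi)^t* *m (1%:M - Psi) by exact: psd_gram.
rewrite trmxCD trmxCN trmxC1 max_entangled_hermitian mulmxBl !mulmxBr !mulmx1 mul1mx.
by rewrite max_entangled_proj subrr subr0.
Qed.

(** The swap operator, exchanging |i>|j> and |j>|i>. It squares to 1, which is the origin of the
    bounds -1/k and 1/k. *)
Definition flip : 'M[C]_(k * k) := \matrix_(p, q)
  (((mxtens_unindex p).1 == (mxtens_unindex q).2) &&
   ((mxtens_unindex p).2 == (mxtens_unindex q).1))%:R.

Lemma ptransB_max_entangled : ptransB Psi = k%:R^-1 *: flip.
Proof.
rewrite max_entangled_rankone ptransBZ; congr (_ *: _); apply/matrixP => p q.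
rewrite !mxE big_ord1 !mxE !mxtens_indexK /= rmorph_nat -natrM mulnb.
by rewrite [(_ == (mxtens_unindex p).2)]eq_sym.
Qed.

Lemma flip_hermitian : flip^t* = flip.
Proof.
apply/matrixP => p q; rewrite !mxE rmorph_nat; congr ((_ : bool)%:R).
by rewrite andbC; congr andb; rewrite eq_sym.
Qed.

Lemma flipK : flip *m flip = 1%:M.
Proof.
apply/matrixP => p q.
case: (mxtens_indexP p) => p1 p2; case: (mxtens_indexP q) => q1 q2.
rewrite mxE (bigD1 (mxtens_index (p2, p1))) //= big1 ?addr0 => [|r].
  rewrite !mxE !mxtens_indexK /= !eqxx mul1r.
  by rewrite (can_eq (@mxtens_indexK k k)) xpair_eqE andbC.
case: (mxtens_indexP r) => r1 r2; rewrite (can_eq (@mxtens_indexK k k)) xpair_eqE => rp.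
rewrite !mxE !mxtens_indexK /=.
by rewrite [p1 == _]eq_sym [p2 == _]eq_sym andbC (negPf rp) mul0r.
Qed.

(** For e = 1 or -1 the square of 1 + e F is 2(1 + e F), so 1 + e F is half of a Gram matrix. *)
Lemma flip_psd (e : C) : e = 1 \/ e = -1 -> psd (1%:M + e *: flip).
Proof.
move=> he; have e1 : e * e = 1 by case: he => ->; rewrite ?mulrNN mulr1.
have ec : Num.conj e = e by case: he => ->; rewrite ?rmorphN rmorph1.
have -> : 1%:M + e *: flip =
    2^-1 *: ((1%:M + e *: flip)^t* *m (1%:M + e *: flip)).
  rewrite trmxCD trmxCZ trmxC1 flip_hermitian ec mulmxDl !mulmxDr !mulmx1 mul1mx.
  rewrite -scalemxAl -scalemxAr scalerA e1 scale1r flipK.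
  by rewrite [e *: flip + 1%:M]addrC -mulr2n -[(_ + _) *+ 2]scaler_nat scalerA mulVf ?scale1r //.
by apply: psdZ; [rewrite invr_ge0 ler0n|exact: psd_gram].
Qed.

End MaxEntangled.

Section Tests.
Variables a b : nat.
Local Notation N := (a * b)%N.
Implicit Types M rho : 'M[C]_N.

(* With D = 1, F the flip, E = 1 and X the partial transpose of a test, this
   splits the transposed Choi matrix over the two eigenspaces of F. *)
Lemma rains_choi_identity m n (X E : 'M[C]_m) (F D : 'M[C]_n) (k : C) :
  k != 0 -> k - 1 != 0 -> k + 1 != 0 ->
  X^T *t (k^-1 *: F) + (E - X)^T *t ((k ^+ 2 - 1)^-1 *: (D - k^-1 *: F)) =
  (2 * k * (k + 1))^-1 *: ((E + k *: X)^T *t (D + 1 *: F)) +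
  (2 * k * (k - 1))^-1 *: ((E - k *: X)^T *t (D + -1 *: F)).
Proof.
move=> k0 km kp; apply/matrixP => p q.
case: (mxtens_indexP p) => p1 p2; case: (mxtens_indexP q) => q1 q2.
rewrite [LHS]mxE [RHS]mxE [X in _ = X + _]mxE [X in _ = _ + X]mxE.
rewrite !tensmxE ![((_ : 'M[C]_m)^T _ _)]mxE.
rewrite ![((_ *: _ : 'M[C]_n) _ _)]mxE ![((_ + _ : 'M[C]_n) _ _)]mxE.
rewrite ![((- _ : 'M[C]_n) _ _)]mxE ![((_ *: _ : 'M[C]_n) _ _)]mxE.
rewrite ![((_ + _ : 'M[C]_m) _ _)]mxE ![((- _ : 'M[C]_m) _ _)]mxE.
rewrite ![((_ *: _ : 'M[C]_m) _ _)]mxE.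
have -> : k ^+ 2 - 1 = (k - 1) * (k + 1) by ring.
move: (X _ _) (F _ _) (E _ _) (D _ _) => x f e d.
by field; rewrite k0 km kp.
Qed.

(** The bounds on M^{T_B} are multiplied by k, which avoids inverses and puts k M in the ball C. *)
Definition ppt_test (k : nat) M := [/\ psd M, psd (1%:M - M),
  psd (1%:M - k%:R *: ptransB M) & psd (1%:M + k%:R *: ptransB M)].

Lemma fidelity_ppt_test rho k x : (0 < k)%N -> fidelities rho k x ->
  exists2 M, ppt_test k M & x = rtrace (M *m rho).
Proof.
move=> k0 [Pi ppt ->].
pose M := \matrix_(p < N, q < N) \tr (Pi (delta_mx q p) *m max_entangled R k).
have ME X : \tr (M *m X) = \tr (Pi X *m max_entangled R k).
  exact: tr_adjoint_mul.
have [cp tp _] := ppt.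
exists M; last by rewrite /rtrace ME.
have k0C : k%:R != 0 :> C by rewrite pnatr_eq0 -lt0n.
(* Trace preservation carries the identity term through Pi, so 1 + e k M^{T_B} is tested by 1 + e k
   Psi_k, whose partial transpose is 1 + e F with F the swap. *)
have cE (e : C) (v : 'rV[C]_N) : \tr ((1%:M + e *: (k%:R *: ptransB M)) *m (v^t* *m v)) =
    \tr (Pi (ptransB (v^t* *m v)) *m (1%:M + e *: (k%:R *: max_entangled R k))).
  rewrite mulmxDl mul1mx -!scalemxAl mulmxDr mulmx1 -2!scalemxAr !mxtraceD !mxtraceZ.
  by rewrite tr_ptransB_mul ME tp mxtrace_ptransB.
have sgn (e : C) : e = 1 \/ e = -1 -> psd (1%:M + e *: (k%:R *: ptransB M)).
  move=> he; apply/psd_tr => v; rewrite cE; apply: PPT_tr_ge0 => //.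
    by rewrite ptransBK; exact: psd_gram.
  rewrite ptransBD ptransB1 2!ptransBZ ptransB_max_entangled // [k%:R *: _]scalerA.
  by rewrite mulfV // scale1r; exact: flip_psd.
split.
- apply/psd_tr => v; rewrite ME; apply: psd_mulmx_tr_ge0.
    by apply: positive_of_completely_positive => //; exact: psd_gram.
  exact: max_entangled_psd.
- apply/psd_tr => v; rewrite mulmxBl mul1mx raddfB /= ME -tp.
  rewrite -[X in \tr X - _]mulmx1 -raddfB /= -mulmxBr.
  apply: psd_mulmx_tr_ge0; last exact: max_entangled_compl_psd.
  by apply: positive_of_completely_positive => //; exact: psd_gram.
- by have := sgn (-1); rewrite scaleN1r; apply; right.
- by have := sgn 1; rewrite scale1r; apply; left.
Qed.

Lemma ppt_test_fidelity rho k M : (1 < k)%N -> is_state rho -> ppt_test k M ->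
  fidelities rho k (rtrace (M *m rho)).
Proof.
move=> k1 [rhop rho1] [Mp Mp' Tm Tp]; have k0 : (0 < k)%N by exact: ltnW.
(* The projection 1 - Psi_k has trace k^2 - 1; [c] normalises it to a state. *)
pose Psi := max_entangled R k; pose c : C := (k%:R ^+ 2 - 1)^-1.
have kC : 1 < k%:R :> C by rewrite ltr1n.
have k0C : k%:R != 0 :> C by rewrite pnatr_eq0 -lt0n.
have k1C : k%:R - 1 != 0 :> C by rewrite subr_eq0 gt_eqF.
have k1C' : k%:R + 1 != 0 :> C by rewrite gt_eqF // ltr_pwDl // ler0n.
have k2C : k%:R ^+ 2 - 1 = (k%:R - 1) * (k%:R + 1) :> C by ring.
have c0 : 0 <= c.
  by rewrite invr_ge0 k2C mulr_ge0 ?subr_ge0 ?addr_ge0 ?ler0n // ltW.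
have Qp : psd (c *: (1%:M - Psi)).
  by apply: psdZ => //; exact: max_entangled_compl_psd.
pose Pi : {linear 'M[C]_N -> 'M[C]_(k * k)} :=
  mprep M Psi \+ mprep (1%:M - M) (c *: (1%:M - Psi)).
exists Pi.
  split.
  - move=> d X Xp; rewrite ampliationD; apply: psdD.
      exact: (mprep_completely_positive Mp (@max_entangled_psd k k0)).
    exact: (mprep_completely_positive Mp' Qp).
  - move=> X; rewrite /= /mprep mxtraceD mxtraceZ max_entangled_tr //.
    rewrite 2!mxtraceZ raddfB /= mxtrace1 max_entangled_tr // natrM -expr2 mulVf; last by rewrite k2C mulf_neq0.
    by rewrite !mulr1 -mxtraceD -mulmxDl addrC subrK mul1mx.
  rewrite choiD !choi_mprep ptransBBD !ptransBB_tens.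
  rewrite ptransBZ ptransBD ptransBN !ptransB1 ptransB_max_entangled //.
  rewrite !ptransB_trmx ptransBD ptransBN ptransB1.
  have Fp := @flip_psd k 1 (or_introl erefl).
  have Fm := @flip_psd k (-1) (or_intror erefl).
  set F := flip k in Fp Fm *; set m := ptransB M in Tm Tp *; clearbody F m.
  (* The transposed Choi matrix becomes a combination, with nonnegative coefficients because k > 1,
     of tensor products of positive matrices: here both bounds on k M^{T_B} enter. *)
  rewrite (rains_choi_identity _ _ _ _ k0C k1C k1C').
  apply: psdD; apply: psdZ.
  - by rewrite invr_ge0 !mulr_ge0 ?addr_ge0 ?ler0n.
  - exact: (psd_tens (psd_trmx Tp) Fp).
  - by rewrite invr_ge0 !mulr_ge0 ?subr_ge0 ?ler0n // ltW.
  - exact: (psd_tens (psd_trmx Tm) Fm).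
have PsiT : \tr Psi = 1 by exact: max_entangled_tr.
have PsiP : Psi *m Psi = Psi by exact: max_entangled_proj.
rewrite -/Psi /rtrace /= /mprep; clear Pi Qp; clearbody Psi.
move: (\tr (M *m rho)) (\tr ((1%:M - M) *m rho)) => t s.
rewrite mulmxDl -!scalemxAl mxtraceD !mxtraceZ mulmxBl mul1mx PsiP subrr mxtrace0.
by rewrite PsiT !mulr0 addr0 mulr1.
Qed.

(** For k = 1 the output space has a single state; discarding the input and preparing it has
    fidelity 1. *)
Lemma fidelities_1 rho : is_state rho -> fidelities rho 1 1.
Proof.
move=> [rhop rho1]; exists (mprep (1%:M : 'M[C]_N) (1%:M : 'M[C]_(1 * 1))).
  split.
  - by apply: mprep_completely_positive; exact: psd1.
  - by move=> X; rewrite /= /mprep mul1mx mxtraceZ mxtrace1 mulr1.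
  - rewrite choi_mprep trmx1 ptransBB_tens !ptransB1.
    by apply: psd_tens; exact: psd1.
by rewrite /rtrace /= /mprep mul1mx rho1 scale1r mul1mx max_entangled_tr.
Qed.

End Tests.
End Rains.

(** * Closedness, convexity and norm bounds of positivity conditions *)

Section OptimalTests.
Variable R : realType.
Local Notation C := R[i].

Lemma sup_is_max (S : set R) x : is_max S x -> sup S = x.
Proof.
move=> [Sx xub]; apply/eqP; rewrite eq_le; apply/andP; split.
  by apply: ge_sup => //; exists x.
by apply: ub_le_sup => //; exists x.
Qed.

Lemma inf_is_min (S : set R) x : is_min S x -> inf S = x.
Proof.
move=> [Sx xlb]; apply/eqP; rewrite eq_le; apply/andP; split.
  by apply: ge_inf => //; exists x.
by apply: lb_le_inf => //; exists x.
Qed.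

Lemma convexI N (S T : set 'rV[R]_N) : convex S -> convex T -> convex (S `&` T).
Proof. by move=> Sc Tc x y t t01 [? ?] [? ?]; split; [exact: Sc|exact: Tc]. Qed.

Section Affine.
Variables (n m : nat) (A : 'M[C]_m) (L : 'M[C]_n -> 'M[C]_m) (L' : 'M[C]_m -> 'M[C]_n).
Hypothesis Ah : A^t* = A.
Hypothesis Lh : forall X, X^t* = X -> (L X)^t* = L X.
Hypothesis Lh' : forall X, X^t* = X -> (L' X)^t* = L' X.
Hypothesis LL' : forall X Y, \tr (L X *m Y) = \tr (X *m L' Y).

(** Testing positivity against the rank-one matrix of v gives a half-space whose normal is the image
    of that matrix under [L'], the adjoint of [L]. *)
Let psd_affineE : [set x | psd (A + L (hmx x))] = [set x | forall v : 'rV[C]_m,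
  - rtrace (A *m (v^t* *m v)) <= dot x (hvec (L' (v^t* *m v)))].
Proof.
have h x : (A + L (hmx x))^t* = A + L (hmx x).
  by rewrite trmxCD Ah Lh //; exact: hmx_hermitian.
apply/seteqP; split=> x /= hx.
  move=> v; have /(psd_rtraceP (h x))/(_ v) := hx.
  rewrite mulmxDl rtraceD -rtrace_hmx; last by apply: Lh'; exact: rankone_hermitian.
  by rewrite [in X in _ -> X]/rtrace -LL' -/(rtrace _); lra.
apply/(psd_rtraceP (h x)) => v; have := hx v.
rewrite mulmxDl rtraceD -rtrace_hmx; last by apply: Lh'; exact: rankone_hermitian.
by rewrite [X in _ <= X -> _]/rtrace -LL' -/(rtrace _); lra.
Qed.

Lemma closed_psd_affine : closed [set x | psd (A + L (hmx x))].
Proof. rewrite psd_affineE; exact: closed_halfspaces. Qed.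

Lemma convex_psd_affine : convex [set x | psd (A + L (hmx x))].
Proof. rewrite psd_affineE; exact: convex_halfspaces. Qed.

End Affine.

Section Scaled.
Variables (n : nat) (A : 'M[C]_n) (c : R).
Hypothesis Ah : A^t* = A.

Let cconj : Num.conj (c%:C) = c%:C.
Proof. exact: conjc_real. Qed.

Lemma psd_scaled_closed_convex :
  let S := [set x | psd (A + c%:C *: hmx x)] in closed S /\ convex S.
Proof.
have Lh (X : 'M[C]_n) : X^t* = X -> (c%:C *: X)^t* = c%:C *: X.
  by move=> Xh; rewrite trmxCZ Xh cconj.
have LL (X Y : 'M[C]_n) : \tr (c%:C *: X *m Y) = \tr (X *m (c%:C *: Y)).
  by rewrite -scalemxAl -scalemxAr.
by split; [exact: (closed_psd_affine Ah Lh Lh LL)|exact: (convex_psd_affine Ah Lh Lh LL)].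
Qed.

End Scaled.

Lemma psd_ptransB_closed_convex (a b : nat) (A : 'M[C]_(a * b)) (c : R) :
  A^t* = A ->
  let S := [set x | psd (A + c%:C *: ptransB (hmx x))] in closed S /\ convex S.
Proof.
move=> Ah; have cconj : Num.conj (c%:C) = c%:C by exact: conjc_real.
have Lh (X : 'M[C]_(a * b)) : X^t* = X -> (c%:C *: ptransB X)^t* = c%:C *: ptransB X.
  by move=> Xh; rewrite trmxCZ ptransB_trmxC Xh cconj.
have LL (X Y : 'M[C]_(a * b)) :
    \tr (c%:C *: ptransB X *m Y) = \tr (X *m (c%:C *: ptransB Y)).
  by rewrite -scalemxAl -scalemxAr !mxtraceZ tr_ptransB_mul.
by split; [exact: (closed_psd_affine Ah Lh Lh LL)|exact: (convex_psd_affine Ah Lh Lh LL)].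
Qed.

(** 1 - Y^2 is the product of two positive matrices, so its trace is nonnegative. This bounds
    effects and the ball C in Euclidean norm. *)
Lemma rtrace_sqr_le n (Y : 'M[C]_n) : psd (1%:M - Y) -> psd (1%:M + Y) ->
  rtrace (Y *m Y) <= n%:R.
Proof.
move=> Ym Yp; have := rtrace_ge0 (psd_mulmx_tr_ge0 Ym Yp).
have -> : (1%:M - Y) *m (1%:M + Y) = 1%:M - Y *m Y.
  by rewrite mulmxBl !mulmxDr !mulmx1 !mul1mx opprD addrA addrK.
rewrite rtraceD rtraceN subr_ge0 /rtrace mxtrace1.
by rewrite (_ : complex.Re n%:R = n%:R) // -(rmorph_nat (real_complex R)).
Qed.

Lemma trace_norm_sqr_le1 n (A : 'M[C]_n) : A^t* = A -> trace_norm A <= 1 ->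
  rtrace (A *m A) <= 1.
Proof.
move=> Ah; have [U Uu [d ->]] := spectral_decomposition Ah.
rewrite trace_norm_spectral // => le1; apply: le_trans (le1).
rewrite /rtrace tr_unitary_diag unitary_conjK // raddf_sum /=.
apply: ler_sum => i _; rewrite !mxE eqxx mulr1n -rmorphM /=.
have d1 : `|d i| <= 1.
  by apply: le_trans le1; rewrite (bigD1 i) //= lerDl sumr_ge0.
by apply: le_trans (ler_norm _) _; rewrite normrM ler_piMl.
Qed.

Lemma psd_compl_hermitian n (Y : 'M[C]_n) : psd (1%:M - Y) -> Y^t* = Y.
Proof.
move=> /psd_hermitian; rewrite trmxCD trmxCN trmxC1 => /addrI/eqP.
by rewrite eqr_opp => /eqP.
Qed.

End OptimalTests.

(** * The compact convex sets of the duality *)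

Section Sets.
Variables (R : realType) (a b : nat).
Local Notation C := R[i].
Local Notation N := (a * b)%N.
Local Notation V := 'rV[R]_(N * N).

Definition effects : set V := [set x | psd (hmx x) /\ psd (1%:M - hmx x)].

(** The parameter is an inverse radius: [ptrans_ball 1] is the ball C, and for c > 0 the set is
    (1/c) C, written without division. *)
Definition ptrans_ball (c : R) : set V :=
  [set x | psd (1%:M - c%:C *: ptransB (hmx x)) /\
           psd (1%:M + c%:C *: ptransB (hmx x))].

Definition rains_tests (k : nat) : set V := [set x | ppt_test k (hmx x)].

Lemma effects_closed_convex : closed effects /\ convex effects.
Proof.
have -> : effects = [set x | psd (0 + 1%:C *: hmx x)] `&`
    [set x | psd (1%:M + (-1)%:C *: hmx x)].
  by apply/seteqP; split=> x /=; rewrite add0r scale1r rmorphN scaleN1r.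
have [c1 v1] := @psd_scaled_closed_convex R N 0 1 (psd_hermitian (@psd0 R N)).
have [c2 v2] := @psd_scaled_closed_convex R N 1%:M (-1) (trmxC1 R N).
by split; [exact: (closedI c1 c2)|exact: (convexI v1 v2)].
Qed.

Lemma ptrans_ball_closed_convex c : closed (ptrans_ball c) /\ convex (ptrans_ball c).
Proof.
have -> : ptrans_ball c = [set x | psd (1%:M + (- c)%:C *: ptransB (hmx x))] `&`
    [set x | psd (1%:M + c%:C *: ptransB (hmx x))].
  by apply/seteqP; split=> x /=; rewrite rmorphN scaleNr.
have [c1 v1] := @psd_ptransB_closed_convex R a b 1%:M (- c) (trmxC1 R N).
have [c2 v2] := @psd_ptransB_closed_convex R a b 1%:M c (trmxC1 R N).
by split; [exact: (closedI c1 c2)|exact: (convexI v1 v2)].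
Qed.

Lemma effects_bounded x : effects x -> dot x x <= N%:R.
Proof.
move=> [xp xm]; rewrite dot_hmx.
exact: (rtrace_sqr_le xm (psdD (@psd1 R N) xp)).
Qed.

Lemma effects_compact : compact effects.
Proof.
apply: (@compact_dot_bounded R _ N%:R); first by have [] := effects_closed_convex.
exact: effects_bounded.
Qed.

Lemma rtrace_ptransB_mul (X Y : 'M[C]_N) :
  rtrace (ptransB X *m Y) = rtrace (X *m ptransB Y).
Proof. by rewrite /rtrace tr_ptransB_mul. Qed.

Lemma ptrans_ball_compact : compact (ptrans_ball 1).
Proof.
apply: (@compact_dot_bounded R _ N%:R).
  by have [] := ptrans_ball_closed_convex 1.
move=> x [xm xp]; rewrite dot_hmx -[X in X *m _]ptransBK rtrace_ptransB_mul.
by move: xm xp; rewrite scale1r; exact: rtrace_sqr_le.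
Qed.

Lemma rains_testsE k : rains_tests k = effects `&` ptrans_ball k%:R.
Proof.
rewrite /ptrans_ball rmorph_nat.
apply/seteqP; split=> [x [h1 h2 h3 h4]|x [[h1 h2] [h3 h4]]].
  exact: (conj (conj h1 h2) (conj h3 h4)).
exact: (And4 h1 h2 h3 h4).
Qed.

Lemma rains_tests_compact k : compact (rains_tests k).
Proof.
rewrite rains_testsE; apply: compact_closedI; first exact: effects_compact.
by have [] := ptrans_ball_closed_convex k%:R.
Qed.

(** The partial transpose is a self-adjoint involution for the trace pairing, so it carries over the
    duality of trace and operator norms. *)
Lemma trace_norm_polar G : trace_norm (ptransB (hmx G)) <= 1 <->
  forall x, ptrans_ball 1 x -> dot x G <= 1.
Proof.
have Gh : (ptransB (hmx G))^t* = ptransB (hmx G).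
  by rewrite ptransB_trmxC hmx_hermitian.
rewrite trace_norm_le1P //; split=> [h x [xm xp]|h Y Ym Yp].
  rewrite dot_hmx -[X in X *m _]ptransBK rtrace_ptransB_mul.
  by move: xm xp; rewrite scale1r; exact: h.
have Yh : (ptransB Y)^t* = ptransB Y.
  by rewrite ptransB_trmxC (psd_compl_hermitian Ym).
have := h (hvec (ptransB Y)).
rewrite dot_hmx /ptrans_ball /= hvecK // ptransBK scale1r rtrace_ptransB_mul.
by apply; split.
Qed.

Lemma trace_ball_compact :
  compact [set G : V | forall x, ptrans_ball 1 x -> dot x G <= 1].
Proof.
apply: (@compact_dot_bounded R _ 1).
  have -> : [set G : V | forall x, ptrans_ball 1 x -> dot x G <= 1] =
      [set G : V | forall x : {x : V | ptrans_ball 1 x}, -1 <= dot G (- sval x)].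
    apply/seteqP; split=> G /= h.
      by move=> [x hx] /=; rewrite dotNr lerN2 dotC; exact: h.
    move=> x hx; have := h (exist _ x hx).
    by rewrite /= dotNr lerN2 dotC.
  exact: closed_halfspaces.
move=> G /trace_norm_polar h.
rewrite dot_hmx -[X in X *m _]ptransBK rtrace_ptransB_mul.
by apply: trace_norm_sqr_le1 => //; rewrite ptransB_trmxC hmx_hermitian.
Qed.

End Sets.

(** * Attainment of the optimal fidelity and of the optimal test *)

Section Attained.
Variables (R : realType) (a b : nat) (rho : 'M[R[i]]_(a * b)) (eps : R).
Hypothesis rho_state : is_state rho.
Hypothesis eps_itv : 0 < eps < 1.
Local Notation C := R[i].
Local Notation N := (a * b)%N.
Local Notation V := 'rV[R]_(N * N).

Let rhoh : rho^t* = rho.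
Proof. by have [/psd_hermitian] := rho_state. Qed.

Lemma rtrace_test_le1 (M : 'M[C]_N) : psd (1%:M - M) -> rtrace (M *m rho) <= 1.
Proof.
have [rhop rho1] := rho_state => Mm.
have := rtrace_ge0 (psd_mulmx_tr_ge0 Mm rhop).
rewrite mulmxBl mul1mx rtraceD rtraceN {1}/rtrace rho1 /=; lra.
Qed.

(** For k >= 2 the fidelities are the values of a linear functional on a compact set of tests; for k
    = 1 the maximum is 1. The second conjunct hides this distinction: for every k >= 1, any test
    bounds the best fidelity from below. *)
Lemma fidelity_max k : (0 < k)%N -> exists x, is_max (fidelities rho k) x /\
  forall M, ppt_test k M -> rtrace (M *m rho) <= x.
Proof.
case: k => [//|[|k]] _.
  exists 1; split; last by move=> M [_ Mm _ _]; exact: rtrace_test_le1.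
  split; first exact: fidelities_1.
  move=> x /(@fidelity_ppt_test R a b rho 1 x isT)[M [_ Mm _ _] ->].
  exact: rtrace_test_le1.
have t0 : @rains_tests R a b k.+2 !=set0.
  exists (hvec 0); rewrite /rains_tests /= hvecK; last exact: psd_hermitian (@psd0 _ _).
  split; [exact: psd0|rewrite subr0; exact: psd1| |];
    rewrite -[X in ptransB X](scale0r 0) ptransBZ scale0r scaler0 ?subr0 ?addr0; exact: psd1.
have [x0] : exists2 c, c \in @rains_tests R a b k.+2 &
    forall t, t \in @rains_tests R a b k.+2 -> dot t (hvec rho) <= dot c (hvec rho).
  apply: (@compact_EVT_max V R (fun x => dot x (hvec rho)) (@rains_tests R a b k.+2)) => //.
    exact: rains_tests_compact.
  by apply: continuous_subspaceT => x; exact: dot_continuous.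
move=> /set_mem x0t x0max.
have ub M : ppt_test k.+2 M -> rtrace (M *m rho) <= rtrace (hmx x0 *m rho).
  move=> Mt; have [/psd_hermitian Mh _ _ _] := Mt.
  rewrite -(hvecK Mh) !rtrace_hmx //; apply: x0max.
  by apply: mem_set; rewrite /rains_tests /= hvecK.
exists (rtrace (hmx x0 *m rho)); split=> //; split.
  exact: ppt_test_fidelity.
by move=> x /(@fidelity_ppt_test R a b rho k.+2 x isT)[M Mt ->]; exact: ub.
Qed.

Lemma F_PPT_max k : (0 < k)%N -> is_max (fidelities rho k) (F_PPT rho k).
Proof. by move=> /fidelity_max[x [xm _]]; rewrite /F_PPT (sup_is_max xm). Qed.

Definition accepting : set V :=
  @effects R a b `&` [set x | 1 - eps <= dot x (hvec rho)].

Lemma acceptingP x : accepting x <->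
  [/\ psd (hmx x), psd (1%:M - hmx x) & 1 - rtrace (hmx x *m rho) <= eps].
Proof.
rewrite /accepting /effects /= rtrace_hmx //; split=> [[[p m] h]|[p m h]].
  by split=> //; lra.
by split=> //; lra.
Qed.

Let halfspaceE : [set x : V | 1 - eps <= dot x (hvec rho)] =
  [set x | forall i : unit, 1 - eps <= dot x (hvec rho)].
Proof. by apply/seteqP; split=> x h => [_|]; [exact: h|exact: (h tt)]. Qed.

Lemma accepting_compact : compact accepting.
Proof.
apply: compact_closedI; first exact: effects_compact.
by rewrite halfspaceE; exact: (@closed_halfspaces _ _ unit (fun=> _) (fun=> _)).
Qed.

Lemma accepting_convex : convex accepting.
Proof.
apply: convexI; first by have [] := effects_closed_convex R a b.
by rewrite halfspaceE; exact: (@convex_halfspaces _ _ unit (fun=> _) (fun=> _)).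
Qed.

Lemma accepting1 : accepting (hvec 1%:M).
Proof.
apply/acceptingP; rewrite hvecK ?trmxC1 // subrr mul1mx.
have [_ rho1] := rho_state; split; [exact: psd1|exact: psd0|].
by rewrite /rtrace rho1 /=; have [? ?] := andP eps_itv; lra.
Qed.

Lemma test_values_min (G : 'M[C]_N) : G^t* = G ->
  is_min (test_values rho eps G) (inf (test_values rho eps G)).
Proof.
move=> Gh; have [x0] : exists2 c, c \in accepting &
    forall t, t \in accepting -> dot c (hvec G) <= dot t (hvec G).
  apply: (@compact_EVT_min V R (fun x => dot x (hvec G)) accepting).
  - by exists (hvec 1%:M); exact: accepting1.
  - exact: accepting_compact.
  by apply: continuous_subspaceT => x; exact: dot_continuous.
move=> /set_mem x0a x0min.
suff m : is_min (test_values rho eps G) (dot x0 (hvec G)) by rewrite (inf_is_min m).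
split; first by exists (hmx x0); [exact/acceptingP|rewrite rtrace_hmx].
move=> _ [M [Mp Mm Me] ->].
have Mh := psd_hermitian Mp.
rewrite -{1}(hvecK Mh) rtrace_hmx //; apply: x0min; apply: mem_set; apply/acceptingP.
by rewrite hvecK.
Qed.

End Attained.

(** * The saddle value v, linking distillability with hypothesis testing *)

Section SaddlePoint.
Variables (R : realType) (a b : nat) (rho : 'M[R[i]]_(a * b)) (eps : R).
Hypothesis rho_state : is_state rho.
Hypothesis eps_itv : 0 < eps < 1.
Local Notation C := R[i].
Local Notation N := (a * b)%N.

Lemma ptrans_ball_scale (c c' : R) (x : 'rV[R]_(N * N)) : 0 <= c <= 1 ->
  ptrans_ball c' x -> ptrans_ball (c * c') x.
Proof.
move=> /andP[c0 c1] [xm xp].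
have shrink (X : 'M[C]_N) : psd (1%:M + X) -> psd (1%:M + c%:C *: X).
  move=> Xp; have -> : 1%:M + c%:C *: X = (1 - c)%:C *: 1%:M + c%:C *: (1%:M + X).
    by rewrite scalerDr addrA -scalerDl -rmorphD subrK scale1r.
  have c0' : 0 <= c%:C :> C by rewrite ler0c.
  have c1' : 0 <= (1 - c)%:C :> C by rewrite ler0c subr_ge0.
  exact: (psdD (psdZ c1' (@psd1 R N)) (psdZ c0' Xp)).
split; rewrite rmorphM -scalerA.
  rewrite -scalerN; apply: shrink. exact: xm.
by apply: shrink; exact: xp.
Qed.

Lemma ptrans_ballZ (c c' : R) (x : 'rV[R]_(N * N)) :
  ptrans_ball c (c' *: x) <-> ptrans_ball (c * c') x.
Proof. by rewrite /ptrans_ball /= hmxZ ptransBZ scalerA -rmorphM. Qed.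

Lemma ptrans_ball_hvec (c : R) (Y : 'M[C]_N) : Y^t* = Y ->
  ptrans_ball c (hvec Y) =
  (psd (1%:M - c%:C *: ptransB Y) /\ psd (1%:M + c%:C *: ptransB Y)).
Proof. by move=> Yh; rewrite -[in RHS](hvecK Yh). Qed.

Definition trace_ball : set 'M[C]_N :=
  [set G | G \is hermsymmx /\ trace_norm (ptransB G) <= 1].

Lemma saddle_value : exists v : R, [/\ 0 < v <= 1,
  forall k, (0 < k)%N -> (1 - eps <= F_PPT rho k) = (k%:R * v <= 1),
  forall G, trace_ball G -> inf (test_values rho eps G) <= v &
  exists2 G, trace_ball G & inf (test_values rho eps G) = v].
Proof.
have [e0 e1] := andP eps_itv.
have [ball_c ball_v] := @ptrans_ball_closed_convex R a b 1.
have ball0 : ptrans_ball 1 (0 : 'rV[R]_(N * N)).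
  have [_] := ptrans_ballZ 1 0 (0 : 'rV[R]_(N * N)); rewrite scale0r mulr0; apply.
  by rewrite /ptrans_ball /= rmorph0 scale0r subr0 addr0; split; exact: psd1.
have [||||||| v [v0 [Y Yb YK] [G0 G0p G0v]]] :=
    @gauge_duality R _ (@accepting R a b rho eps) (ptrans_ball 1).
- by exists (hvec 1%:M); exact: accepting1.
- exact: accepting_compact.
- exact: accepting_convex.
- by [].
- exact: ptrans_ball_compact.
- by [].
- exact: trace_ball_compact.
(* The identity is its own partial transpose, so it lies in both K and C. *)
have v1 : v <= 1.
  apply: le_trans (G0v _ (accepting1 rho_state eps_itv)) _; apply: G0p.
  rewrite (ptrans_ball_hvec 1 (@trmxC1 R N)) ptransB1 scale1r subrr.
  split; [exact: psd0|exact: (psdD (@psd1 R N) (@psd1 R N))].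
(* v = 0 would put the zero operator in K, although it accepts with probability 0 < 1 - eps. *)
have vgt0 : 0 < v.
  rewrite lt_def v0 andbT; apply/eqP => vE.
  have := YK; rewrite vE scale0r => -[_] /=.
  by rewrite dotC dot0r; lra.
have [/(acceptingP eps rho_state)[Mp Mm Me]] := conj YK I => _.
exists v; split.
- by rewrite vgt0.
- move=> k k0; apply/idP/idP => [h|kv].
    (* A test M achieving the optimum lies in K, and k M lies in C; hence k v <= k Tr M G0 <= 1. *)
    have [/(fidelity_ppt_test k0)[M Mt FM] _] := F_PPT_max rho_state k0.
    have [Np Nm _ _] := Mt; have Mh := psd_hermitian Np.
    have xa : accepting rho eps (hvec M).
      by apply/(acceptingP eps rho_state); rewrite hvecK //; split=> //; lra.
    have xt : @rains_tests R a b k (hvec M) by rewrite /rains_tests /= hvecK.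
    move: xt; rewrite rains_testsE => -[_ xt].
    have := G0p (k%:R *: hvec M); rewrite ptrans_ballZ mul1r => /(_ xt).
    rewrite dotZl => h1; apply: le_trans h1; apply: ler_wpM2l => //; exact: G0v.
  (* v Y lies in K, and k v <= 1 shrinks Y within C, so v Y is a test for k. *)
  have [x [xm xt]] := fidelity_max rho_state k0.
  rewrite /F_PPT (sup_is_max xm); apply: le_trans (xt (hmx (v *: Y)) _); first lra.
  suff h : @rains_tests R a b k (v *: Y) by exact: h.
  have [YKe _] := YK; rewrite rains_testsE; split; first exact: YKe.
  apply/ptrans_ballZ.
  rewrite -[X in ptrans_ball X _]mulr1; apply: ptrans_ball_scale Yb.
  by rewrite kv mulr_ge0.
(* Weak duality: the accepting test v Y pairs with G to at most v, as G is in the polar of C. *)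
- move=> G [/hermsymmxP Gh Gn].
  have [_ lb] := test_values_min rho_state eps_itv Gh.
  apply: (@le_trans _ _ (rtrace (hmx (v *: Y) *m G))).
    by apply: lb; exists (hmx (v *: Y)).
  rewrite rtrace_hmx // dotZl ler_piMr //.
  by move: Y Yb {YK Mp Mm Me lb}; apply/trace_norm_polar; rewrite hvecK.
exists (hmx G0).
  split; first exact/hermsymmxP/hmx_hermitian.
  exact/trace_norm_polar.
have G0t : trace_norm (ptransB (hmx G0)) <= 1 by exact/trace_norm_polar.
have [ti lb] := test_values_min rho_state eps_itv (hmx_hermitian G0).
apply/eqP; rewrite eq_le; apply/andP; split.
  apply: (@le_trans _ _ (rtrace (hmx (v *: Y) *m hmx G0))).
    by apply: lb; exists (hmx (v *: Y)).
  by rewrite -dot_hmx dotZl ler_piMr //; exact: G0p.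
have [M [Np Nm Ne] ->] := ti; have Mh := psd_hermitian Np.
rewrite -(hvecK Mh) -dot_hmx; apply: G0v.
by apply/(acceptingP eps rho_state); rewrite hvecK.
Qed.

End SaddlePoint.

(** * Logarithms and the integer gap *)

Section Logarithm.
Variable R : realType.

Let ln2_gt0 : 0 < ln 2 :> R.
Proof. by rewrite ln_gt0 // ltr1n. Qed.

Lemma log2e_EFin (x : R) : 0 < x -> log2e x%:E = (ln x / ln 2)%:E.
Proof. by move=> x0; rewrite /log2e lne_EFin. Qed.

Lemma log2e_le0 (x : R) : x <= 0 -> log2e x%:E = -oo%E.
Proof.
move=> x0; rewrite /log2e le0_lneNy ?lee_fin // gt0_mulNye //.
by rewrite lte_fin invr_gt0.
Qed.

Lemma le_log2e (x y : R) : x <= y -> (log2e x%:E <= log2e y%:E)%E.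
Proof.
move=> xy; have [x0|x0] := leP x 0; first by rewrite (log2e_le0 x0) leNye.
have y0 : 0 < y by exact: lt_le_trans xy.
by rewrite !log2e_EFin // lee_fin ler_pM2r ?invr_gt0 // ler_ln.
Qed.

Lemma min_log_integer_gap (v : R) (k : nat) : 0 < v -> (0 < k)%N ->
  k%:R * v <= 1 -> 1 < k.+1%:R * v ->
  let D := (- log2e v%:E)%E in
  exists2 delta : R, is_min (log_integer_gaps D) delta &
    log2e k%:R%:E = (D - delta%:E)%E.
Proof.
move=> v0 k0 kv kv1 D.
have kR : 0 < k%:R :> R by rewrite ltr0n.
have DE : D = (- (ln v / ln 2))%:E by rewrite /D log2e_EFin.
pose l := ln 2 : R; have l0 : 0 < l by [].
have lkv : ln (k%:R * v) = ln k%:R + ln v :> R by rewrite lnM ?posrE.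
have lkv0 : ln (k%:R * v) <= 0 by rewrite ln_le0.
(* 2k >= k + 1 because k >= 1, so 2 k v > 1; this gives delta <= 1. *)
have kv2 : 0 < ln 2 + ln (k%:R * v).
  rewrite -lnM ?posrE ?mulr_gt0 // ln_gt0 // mulrA.
  apply: lt_le_trans kv1 _; rewrite ler_pM2r // -natrM ler_nat.
  by rewrite mul2n -addnn -addn1 leq_add2l.
pose delta := - (ln (k%:R * v) / l).
have kE : log2e k%:R%:E = (D - delta%:E)%E.
  rewrite log2e_EFin // DE -EFinB; congr (_%:E); rewrite /delta lkv /l; ring.
exists delta => //; split.
  split; last by exists k%:Z; rewrite -kE.
  apply/andP; split; first by rewrite /delta -mulNr divr_ge0 ?oppr_ge0 // ltW.
  by rewrite /delta -mulNr ler_pdivrMr // mul1r /l; lra.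
move=> d [/andP[d0 _] [z zE]].
(* For z <= 0 the logarithm is -oo, while D - d is finite. For z > 0, d >= 0 yields z v <= 1 < (k +
   1) v, so z <= k and d >= delta. *)
have [z0|z0] := leP (z%:~R : R) 0.
  by move: zE; rewrite (log2e_le0 z0) DE.
move: zE; rewrite log2e_EFin // DE -EFinB => -[zE].
have zk : z%:~R <= k%:R :> R.
  have zv : z%:~R * v <= 1.
    rewrite -ler_ln ?posrE ?mulr_gt0 // ln1 lnM ?posrE //.
    have -> : ln z%:~R + ln v = - d * ln 2.
      have : (- (ln v / ln 2) - d) * ln 2 = ln z%:~R by rewrite zE divfK // gt_eqF.
      by rewrite mulrBl mulNr divfK ?gt_eqF //; lra.
    by rewrite mulNr oppr_le0 mulr_ge0 // ltW.
  case: z z0 zv {zE} => [m|m] z0 zv; last by move: z0; rewrite NegzE mulrNz oppr_gt0 ltNge ler0n.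
  rewrite -[_%:~R]/(m%:R) ler_nat -ltnS -(@ltr_nat R) -(ltr_pM2r v0).
  exact: le_lt_trans kv1.
have : ln z%:~R / ln 2 <= ln k%:R / ln 2 :> R.
  by rewrite ler_pM2r ?invr_gt0 // ler_ln ?posrE.
by rewrite /delta lkv mulrDl /l -zE; lra.
Qed.

End Logarithm.

(* The first three conjuncts say that the maxima and minima in the definitions
   of F_PPT, ED_PPT and DH, which are written there with sup and inf, are
   attained; the fourth says the same of the minimum over G. *)
Theorem theorem4 (R : realType) (a b : nat) (rho : 'M[R[i]]_(a * b)) (eps : R)
    (rho_state : is_state rho) (eps_itv : 0 < eps < 1) :
  [/\ forall k : nat, (1 <= k)%N -> is_max (fidelities rho k) (F_PPT rho k),
      is_max (distillable_dims rho eps) (sup (distillable_dims rho eps)),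
      forall G : 'M[R[i]]_(a * b), G \is hermsymmx ->
        is_min (test_values rho eps G) (inf (test_values rho eps G)),
      is_min (DH_values rho eps) (min_DH rho eps)
    & exists2 delta : R,
        is_min (log_integer_gaps (min_DH rho eps)) delta
        & ED_PPT rho eps = (min_DH rho eps - delta%:E)%E].
Proof.
have [v [v01 vF vle [G1 G1b G1v]]] := saddle_value rho_state eps_itv.
have /andP[v0 v1] := v01.
pose k := Num.truncn v^-1.
have /andP[kle klt] : k%:R <= v^-1 < k.+1%:R.
  by apply: truncn_itv; rewrite invr_ge0 ltW.
have kP j : (j%:R * v <= 1) = (j <= k)%N.
  rewrite -ler_pdivlMr // mul1r; apply/idP/idP => [h|h].
    by rewrite -ltnS -(ltr_nat R); exact: le_lt_trans klt.
  by apply: le_trans kle; rewrite ler_nat.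
have k0 : (0 < k)%N by rewrite -kP mul1r.
have dims : is_max (distillable_dims rho eps) k%:R.
  split; first by exists k => //; split=> //; rewrite vF // kP.
  by move=> _ [j [j0 jF] ->]; rewrite ler_nat -kP -vF.
(* - log reverses the order, so the G with the largest inner minimum minimises D_H; a G whose inner
   minimum is <= 0 contributes +oo. *)
have DHmin : is_min (DH_values rho eps) (- log2e v%:E)%E.
  split; first by exists G1 => //; rewrite /DH G1v.
  by move=> _ [G Gb <-]; rewrite /DH leeN2; apply/le_log2e/vle.
have DE : min_DH rho eps = (- log2e v%:E)%E.
  apply/eqP; rewrite eq_le; have [DHin DHlb] := DHmin; apply/andP; split.
    exact: ereal_inf_lbound.
  exact: le_ereal_inf_tmp.
split.
- by move=> j; exact: F_PPT_max.
- by rewrite (sup_is_max dims).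
- by move=> G /hermsymmxP; exact: test_values_min.
- by rewrite DE.
rewrite DE /ED_PPT (sup_is_max dims); apply: min_log_integer_gap => //.
  by rewrite kP.
by rewrite ltNge kP ltnn.
Qed.
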